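(* Let $R$ be a strictly local ring, $\mathscr{U}$ a Grothendieck universe with $R\in\mathscr{U}$, and $\sigma$ the smallest ordinal that is not an element of $\mathscr{U}$. Let $R_\nu$, $\nu<\sigma$, be the direct system of rings defined in the context. For each ordinal $\nu<\sigma$, the ring $R_\nu$ is strictly local, and the transition maps $R_\gamma\to R_\nu$, $\gamma\leq\nu$, are local, faithfully flat, and integral.
   Context: Rings are commutative with unit. A strictly local ring is a henselian local ring with separably closed residue field. An algebra is finite fppf if it is finite, of finite presentation and faithfully flat. Limit ordinals are nonzero. Construction of $R_\nu$: for a strictly local ring $R\in\mathscr{U}$, let $I(R)$ be a set of representatives (precisely one for each isomorphism class) of the finite fppf $R$-algebras $A$ with $\mathrm{Spec}(A)$ connected, and let $\Phi(R)$ be the set of all finite subsets of $I(R)$, ordered by inclusion. For $\varphi\in\Phi(R)$ put $A_\varphi=\bigotimes_{A\in\varphi}A$, the (unordered) tensor product over $R$; with the obvious maps $A_\varphi\to A_{\varphi'}$ for $\varphi\subset\varphi'$ (inserting units) this is a filtered direct system of $R$-algebras. Put $R_+=\varinjlim_{\varphi\in\Phi(R)}A_\varphi$ (the same definition of $R_+$ makes sense for any ring $R$). By transfinite recursion define, for ordinals $\nu<\sigma$: $R_0=R$; $R_\nu=(R_\gamma)_+$ if $\nu=\gamma+1$ is a successor ordinal; $R_\nu=\varinjlim_{\gamma<\nu}R_\gamma$ if $\nu$ is a limit ordinal. *)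

(* Defs.v *)
From HB Require Import structures.
From mathcomp Require Import all_boot all_order all_algebra.
From mathcomp Require Import finmap separable.
From mathcomp Require Import boolp classical_sets wochoice topology.

Set Implicit Arguments.
Unset Strict Implicit.
Unset Printing Implicit Defensive.

Import Order.TTheory GRing.Theory.
Local Open Scope ring_scope.
Local Open Scope quotient_scope.

(* Rings are [comPzRingType] (commutative with unit, the zero ring allowed), and
   an algebra over R is a ring A together with a ring morphism R -> A.  A fixed
   Grothendieck universe is rendered by the universe of the carriers of rings,
   modules and choice types. *)

Record algebra (R : comPzRingType) := Algebra {
  alg_ring :> comPzRingType;
  alg_map : {rmorphism R -> alg_ring}
}.

Section RestrictionOfScalars.
Context (R S : comPzRingType) (f : {rmorphism R -> S}).

(* S as an R-module through f; the phantom occurrence of f keeps it as a parameter. *)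
Definition restr : Type := let _ := f in S.

HB.instance Definition _ := GRing.Zmodule.on restr.

Let restr_scale (a : R) (x : restr) : restr := f a * (x : S).

Fact restr_scaleA a b v : restr_scale a (restr_scale b v) = restr_scale (a * b) v.
Proof. by rewrite /restr_scale mulrA rmorphM. Qed.

Fact restr_scale1 : left_id 1 restr_scale.
Proof. by move=> v; rewrite /restr_scale rmorph1 mul1r. Qed.

Fact restr_scaleDr : right_distributive restr_scale +%R.
Proof. by move=> a u v; rewrite /restr_scale mulrDr. Qed.

Fact restr_scaleDl v : {morph restr_scale^~ v : a b / a + b}.
Proof. by move=> a b; rewrite /restr_scale rmorphD mulrDl. Qed.

HB.instance Definition _ := GRing.Zmodule_isLmodule.Build R restr
  restr_scaleA restr_scale1 restr_scaleDr restr_scaleDl.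

Lemma restr_scaleE (a : R) (x : restr) : a *: x = f a * (x : S) :> S.
Proof. by []. Qed.

End RestrictionOfScalars.

(* Formal R-linear combinations of elements of X, two of them being identified
   when every admissible map from X to an R-module takes them to the same value.
   For X the set of pure tensors and "admissible" meaning "multilinear" this is
   the tensor product: it is the quotient of the free module on X by the relations
   satisfied by all multilinear maps; see [tensor_univ] and [tensor2_univ]. *)
Section UniversalModule.
Context (R : comPzRingType) (X : Type).
Variable admissible : forall P : lmodType R, (X -> P) -> Prop.
Arguments admissible : clear implicits.

Definition comb : Type := seq (R * {classic X}).

HB.instance Definition _ := Choice.on comb.

Definition comb_eval (P : lmodType R) (f : X -> P) (s : comb) : P :=
  \sum_(u <- s) u.1 *: f u.2.

Definition comb_eq : rel comb := fun s t =>
  `[< forall (P : lmodType R) (f : X -> P),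
        admissible P f -> comb_eval f s = comb_eval f t >].

Fact comb_eq_refl : reflexive comb_eq.
Proof. by move=> s; apply/asboolP. Qed.

Fact comb_eq_sym : symmetric comb_eq.
Proof.
by move=> s t; apply/asboolP/asboolP=> h P f /h.
Qed.

Fact comb_eq_trans : transitive comb_eq.
Proof.
move=> t s u /asboolP st /asboolP tu; apply/asboolP=> P f hf.
by rewrite st // tu.
Qed.

Canonical comb_equiv := EquivRel comb_eq comb_eq_refl comb_eq_sym comb_eq_trans.

Definition univ_module : Type := {eq_quot comb_equiv}.

HB.instance Definition _ : EqQuotient comb comb_equiv univ_module :=
  EqQuotient.on univ_module.
HB.instance Definition _ := Choice.on univ_module.

Implicit Types (q : univ_module) (s t : comb).

Definition univ_eval (P : lmodType R) (f : X -> P) q : P := comb_eval f (repr q).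

Lemma univ_eval_pi (P : lmodType R) (f : X -> P) s :
  admissible P f -> univ_eval f (\pi_univ_module s) = comb_eval f s.
Proof.
move=> hf; rewrite /univ_eval.
have /eqmodP/asboolP : repr (\pi_univ_module s) = s %[mod univ_module].
  by rewrite reprK.
exact.
Qed.

Lemma univ_ext q1 q2 :
  (forall (P : lmodType R) (f : X -> P),
     admissible P f -> univ_eval f q1 = univ_eval f q2) -> q1 = q2.
Proof.
by move=> h; rewrite -[q1]reprK -[q2]reprK; apply/eqmodP/asboolP.
Qed.

Lemma comb_eval_nil (P : lmodType R) (f : X -> P) : comb_eval f [::] = 0.
Proof. exact: big_nil. Qed.

Lemma comb_eval_cat (P : lmodType R) (f : X -> P) s t :
  comb_eval f (s ++ t) = comb_eval f s + comb_eval f t.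
Proof. exact: big_cat. Qed.

Lemma comb_eval_scale (P : lmodType R) (f : X -> P) a s :
  comb_eval f [seq (a * u.1, u.2) | u <- s] = a *: comb_eval f s.
Proof.
rewrite /comb_eval big_map scaler_sumr.
by apply: eq_bigr => u _; rewrite scalerA.
Qed.

Definition univ_zero : univ_module := \pi_univ_module [::].
Definition univ_add q1 q2 : univ_module := \pi_univ_module (repr q1 ++ repr q2).
Definition univ_scale a q : univ_module := \pi_univ_module [seq (a * u.1, u.2) | u <- repr q].
Definition univ_opp q : univ_module := univ_scale (- 1) q.

Let eval0 (P : lmodType R) (f : X -> P) (hf : admissible P f) :
  univ_eval f univ_zero = 0.
Proof. by rewrite univ_eval_pi // comb_eval_nil. Qed.

Let evalD (P : lmodType R) (f : X -> P) (hf : admissible P f) q1 q2 :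
  univ_eval f (univ_add q1 q2) = univ_eval f q1 + univ_eval f q2.
Proof. by rewrite univ_eval_pi // comb_eval_cat. Qed.

Let evalZ (P : lmodType R) (f : X -> P) (hf : admissible P f) a q :
  univ_eval f (univ_scale a q) = a *: univ_eval f q.
Proof. by rewrite univ_eval_pi // comb_eval_scale. Qed.

Fact univ_addA : associative univ_add.
Proof. by move=> p q r; apply: univ_ext => P f hf; rewrite !evalD ?addrA. Qed.

Fact univ_addC : commutative univ_add.
Proof. by move=> p q; apply: univ_ext => P f hf; rewrite !evalD // addrC. Qed.

Fact univ_add0 : left_id univ_zero univ_add.
Proof. by move=> p; apply: univ_ext => P f hf; rewrite evalD // eval0 // add0r. Qed.

Fact univ_addN : left_inverse univ_zero univ_opp univ_add.
Proof.
move=> p; apply: univ_ext => P f hf.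
by rewrite evalD // evalZ // eval0 // scaleN1r addNr.
Qed.

HB.instance Definition _ :=
  GRing.isZmodule.Build univ_module univ_addA univ_addC univ_add0 univ_addN.

Fact univ_scaleA a b q : univ_scale a (univ_scale b q) = univ_scale (a * b) q.
Proof. by apply: univ_ext => P f hf; rewrite !evalZ // scalerA. Qed.

Fact univ_scale1 : left_id 1 univ_scale.
Proof. by move=> q; apply: univ_ext => P f hf; rewrite evalZ // scale1r. Qed.

Fact univ_scaleDr : right_distributive univ_scale +%R.
Proof.
by move=> a p q; apply: univ_ext => P f hf; rewrite evalD // !evalZ // evalD // scalerDr.
Qed.

Fact univ_scaleDl q : {morph univ_scale^~ q : a b / a + b}.
Proof.
by move=> a b; apply: univ_ext => P f hf; rewrite evalD // !evalZ // scalerDl.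
Qed.

HB.instance Definition _ := GRing.Zmodule_isLmodule.Build R univ_module
  univ_scaleA univ_scale1 univ_scaleDr univ_scaleDl.

Lemma univ_eval_linear (P : lmodType R) (f : X -> P) :
  admissible P f -> linear (univ_eval f).
Proof. by move=> hf a p q; rewrite evalD // evalZ. Qed.

Definition univ_lift (P : lmodType R) (f : X -> P) (hf : admissible P f) :
    {linear univ_module -> P} :=
  HB.pack (univ_eval f) (GRing.isLinear.Build _ _ _ _ _ (univ_eval_linear hf)).

Definition univ_gen (x : X) : univ_module := \pi_univ_module [:: (1, x : {classic X})].

Lemma univ_eval_gen (P : lmodType R) (f : X -> P) x :
  admissible P f -> univ_eval f (univ_gen x) = f x.
Proof.
by move=> hf; rewrite univ_eval_pi // /comb_eval big_seq1 scale1r.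
Qed.

Lemma univ_comb q : q = \sum_(u <- repr q) u.1 *: univ_gen u.2.
Proof.
apply: univ_ext => P f hf.
rewrite -[RHS]/(univ_lift hf _) linear_sum; apply: eq_bigr => u _.
by rewrite linearZ /= univ_eval_gen.
Qed.

Lemma univ_eval_unique (P : lmodType R) (f : X -> P) (h : {linear univ_module -> P}) :
  admissible P f -> (forall x, h (univ_gen x) = f x) -> h =1 univ_eval f.
Proof.
move=> hf e q; rewrite {1}[q]univ_comb linear_sum.
by apply: eq_bigr => u _; rewrite linearZ /= e.
Qed.

End UniversalModule.

Section BinaryTensor.
Context (R : comPzRingType).

Definition bilinear_map (M N P : lmodType R) (f : M * N -> P) : Prop :=
  (forall y, linear (fun x => f (x, y))) /\ (forall x, linear (fun y => f (x, y))).

Definition tensor2 (M N : lmodType R) : Type := univ_module (@bilinear_map M N).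

HB.instance Definition _ (M N : lmodType R) := GRing.Lmodule.on (tensor2 M N).

Definition pure2 (M N : lmodType R) (x : M) (y : N) : tensor2 M N :=
  univ_gen (@bilinear_map M N) (x, y).

Lemma pure2_bilinear (M N : lmodType R) :
  @bilinear_map M N (tensor2 M N) (fun z => pure2 z.1 z.2).
Proof.
split=> z a x y; apply: univ_ext => P f hf;
  rewrite univ_eval_linear // !univ_eval_gen //=.
  by rewrite hf.1.
by rewrite hf.2.
Qed.

Lemma tensor2_univ (M N P : lmodType R) (f : M * N -> P) : bilinear_map f ->
  exists h : {linear tensor2 M N -> P},
    (forall x y, h (pure2 x y) = f (x, y)) /\
    (forall h' : {linear tensor2 M N -> P},
       (forall x y, h' (pure2 x y) = f (x, y)) -> h' =1 h).
Proof.
move=> hf; exists (univ_lift hf).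
split=> [x y|h' e] /=; first exact: univ_eval_gen.
by apply: univ_eval_unique => // -[x y]; apply: e.
Qed.

(* id (x) f : M (x) N -> M (x) N' *)
Definition tensor2_map (M N N' : lmodType R) (f : {linear N -> N'}) :
    tensor2 M N -> tensor2 M N' :=
  univ_eval (fun z : M * N => pure2 z.1 (f z.2)).

Lemma tensor2_map_pure (M N N' : lmodType R) (f : {linear N -> N'}) x y :
  tensor2_map f (pure2 x y) = pure2 x (f y) :> tensor2 M N'.
Proof.
rewrite /tensor2_map univ_eval_gen //; have [hl hr] := pure2_bilinear M N'.
split=> [y'|x'] a u v /=; first exact: (hl (f y')).
by rewrite linearP; exact: (hr x').
Qed.

End BinaryTensor.

Section Tensor.
Context (R : comPzRingType) (J : finType).

Definition multilinear_map (M : J -> lmodType R) (P : lmodType R)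
    (f : (forall j, M j) -> P) : Prop :=
  forall (x : forall j, M j) (j : J), linear (fun y : M j => f (dfwith x y)).

(* The unordered tensor product of a finite family of modules. *)
Definition tensor (M : J -> lmodType R) : Type := univ_module (@multilinear_map M).

HB.instance Definition _ (M : J -> lmodType R) := GRing.Lmodule.on (tensor M).

Definition pure (M : J -> lmodType R) (x : forall j, M j) : tensor M :=
  univ_gen (@multilinear_map M) x.

Lemma pure_multilinear (M : J -> lmodType R) :
  @multilinear_map M (tensor M) (@pure M).
Proof.
move=> x j a y z; apply: univ_ext => P f hf.
by rewrite univ_eval_linear // !univ_eval_gen // hf.
Qed.

Lemma tensor_univ (M : J -> lmodType R) (P : lmodType R) (f : (forall j, M j) -> P) :
  multilinear_map f ->
  exists h : {linear tensor M -> P},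
    (forall x, h (pure x) = f x) /\
    (forall h' : {linear tensor M -> P}, (forall x, h' (pure x) = f x) -> h' =1 h).
Proof.
move=> hf; exists (univ_lift hf).
split=> [x|h' e] /=; first exact: univ_eval_gen.
exact: univ_eval_unique.
Qed.

End Tensor.

Section TensorAlgebra.
Context (R : comPzRingType) (J : finType) (A : J -> algebra R).

Let M (j : J) : lmodType R := restr (alg_map (A j)).

Definition alg_tensor : Type := tensor M.

HB.instance Definition _ := GRing.Lmodule.on alg_tensor.

Definition alg_pure (x : forall j, A j) : alg_tensor := pure (M := M) x.

(* (x_j)_j * (y_j)_j = (x_j y_j)_j on pure tensors, extended bilinearly. *)
Definition pmul (x y : forall j, A j) : forall j, A j := fun j => x j * y j.

Implicit Types p q r : alg_tensor.

Let eval (P : lmodType R) (f : (forall j, M j) -> P) (q : alg_tensor) : P :=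
  @univ_eval R _ (@multilinear_map R J M) P f q.

Let evalD (P : lmodType R) (f : (forall j, M j) -> P) p q :
  multilinear_map f -> eval f (p + q) = eval f p + eval f q.
Proof. by move=> hf; exact: (linearD (univ_lift hf)). Qed.

Let evalZ (P : lmodType R) (f : (forall j, M j) -> P) a p :
  multilinear_map f -> eval f (a *: p) = a *: eval f p.
Proof. by move=> hf; exact: (linearZ_LR (univ_lift hf)). Qed.

Let eval_pure (P : lmodType R) (f : (forall j, M j) -> P) x :
  multilinear_map f -> eval f (alg_pure x) = f x.
Proof. exact: univ_eval_gen. Qed.

Let pmulC x y : pmul x y = pmul y x.
Proof. by apply: functional_extensionality_dep => j; rewrite /pmul mulrC. Qed.

Let pmul_dfwith x j (y : A j) z : pmul (dfwith x y) z = dfwith (pmul x z) (y * z j).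
Proof.
apply: functional_extensionality_dep => i; rewrite /pmul.
have [<-|ji] := eqVneq j i; first by rewrite !dfwith_in.
by rewrite !dfwith_out.
Qed.

Let multi_mul (P : lmodType R) (f : (forall j, M j) -> P) z :
  multilinear_map f -> multilinear_map (fun x : forall j, M j => f (pmul x z)).
Proof.
move=> hf x j a u v; rewrite !pmul_dfwith -hf; congr (f (dfwith _ _)).
by rewrite /= [LHS]mulrDl !restr_scaleE mulrA.
Qed.

Let multi_eval (P : lmodType R) (f : (forall j, M j) -> P) q :
  multilinear_map f ->
  multilinear_map (fun x : forall j, M j => eval (fun y => f (pmul x y)) q).
Proof.
move=> hf x j a u v; rewrite /eval /univ_eval /comb_eval scaler_sumr -big_split /=.
apply: eq_bigr => w _; have /(_ x j a u v) -> := multi_mul w.2 hf.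
by rewrite scalerDr !scalerA (mulrC a).
Qed.

Definition tmul (p q : alg_tensor) : alg_tensor :=
  eval (P := tensor M) (fun x => eval (P := tensor M) (fun y => alg_pure (pmul x y)) q) p.

Definition tone : alg_tensor := alg_pure (fun=> 1).

Let pure_multi : multilinear_map (M := M) (P := tensor M) alg_pure.
Proof. exact: (pure_multilinear (M := M)). Qed.

Let eval_comp (P : lmodType R) (f : (forall j, M j) -> P)
    (g : (forall j, M j) -> tensor M) q :
  multilinear_map f -> multilinear_map g ->
  eval f (eval g q) = eval (fun x => eval f (g x)) q.
Proof.
move=> hf hg.
rewrite -[LHS]/(univ_lift hf _) /eval {1}/univ_eval /comb_eval linear_sum.
by apply: eq_bigr => u _; rewrite linearZ.
Qed.

Let eq_eval (P : lmodType R) (f g : (forall j, M j) -> P) q :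
  f =1 g -> eval f q = eval g q.
Proof. by move=> fg; congr (eval _ q); apply: functional_extensionality_dep. Qed.

Let eval_tmul (P : lmodType R) (f : (forall j, M j) -> P) p q :
  multilinear_map f ->
  eval f (tmul p q) = eval (fun x => eval (fun y => f (pmul x y)) q) p.
Proof.
move=> hf; rewrite eval_comp //; last exact: multi_eval.
apply: eq_eval => x; rewrite eval_comp //.
  by apply: eq_eval => y; rewrite eval_pure.
by under eq_fun do rewrite pmulC; apply: multi_mul.
Qed.

Let eval_swap (P : lmodType R) (f : (forall j, M j) -> (forall j, M j) -> P) p q :
  eval (fun x => eval (f x) q) p = eval (fun y => eval (f^~ y) p) q.
Proof.
rewrite /eval /univ_eval /comb_eval.
under eq_bigr do rewrite scaler_sumr.
rewrite exchange_big; apply: eq_bigr => v _.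
rewrite scaler_sumr; apply: eq_bigr => u _.
by rewrite !scalerA mulrC.
Qed.

Fact tmulC : commutative tmul.
Proof.
move=> p q; apply: univ_ext => P f hf; rewrite -!/(eval _ _) !eval_tmul //.
by rewrite eval_swap; apply: eq_eval => x; apply: eq_eval => y; rewrite pmulC.
Qed.

Fact tmulA : associative tmul.
Proof.
move=> p q r; apply: univ_ext => P f hf; rewrite -!/(eval _ _) !eval_tmul //.
  apply: eq_eval => x; rewrite eval_tmul; last first.
    by under eq_fun do rewrite pmulC; apply: multi_mul.
  apply: eq_eval => y; apply: eq_eval => z; congr f.
  by apply: functional_extensionality_dep => j; rewrite /pmul mulrA.
exact: multi_eval.
Qed.

Fact tmul1 : left_id tone tmul.
Proof.
move=> p; apply: univ_ext => P f hf; rewrite -!/(eval _ _) eval_tmul //.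
rewrite eval_pure; last exact: multi_eval.
apply: eq_eval => x; congr f.
by apply: functional_extensionality_dep => j; rewrite /pmul mul1r.
Qed.

Fact tmulDl : left_distributive tmul +%R.
Proof.
move=> p q r; apply: univ_ext => P f hf; rewrite -!/(eval _ _) eval_tmul //.
by rewrite !evalD ?eval_tmul //; apply: multi_eval.
Qed.

HB.instance Definition _ := GRing.Zmodule_isComPzRing.Build alg_tensor
  tmulA tmulC tmul1 tmulDl.

Lemma alg_pureM x y : alg_pure (pmul x y) = alg_pure x * alg_pure y.
Proof.
apply: univ_ext => P f hf; rewrite -!/(eval _ _) eval_tmul // !eval_pure //.
  by under eq_fun do rewrite pmulC; apply: multi_mul.
exact: multi_eval.
Qed.

Lemma alg_pure1 : alg_pure (fun=> 1) = 1.
Proof. by []. Qed.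

Lemma alg_tensor_scaleAl a p q : a *: (p * q) = (a *: p) * q.
Proof.
apply: univ_ext => P f hf; rewrite -!/(eval _ _) evalZ // !eval_tmul //.
by rewrite evalZ //; apply: multi_eval.
Qed.

Definition tensor_map (a : R) : alg_tensor := a *: (1 : alg_tensor).

Fact tensor_map_zmod : zmod_morphism tensor_map.
Proof. by move=> a b; rewrite /tensor_map scalerBl. Qed.

Fact tensor_map_monoid : monoid_morphism tensor_map.
Proof.
split; first by rewrite /tensor_map scale1r.
by move=> a b; rewrite /tensor_map -alg_tensor_scaleAl mul1r scalerA.
Qed.

HB.instance Definition _ :=
  GRing.isZmodMorphism.Build R alg_tensor tensor_map tensor_map_zmod.
HB.instance Definition _ :=
  GRing.isMonoidMorphism.Build R alg_tensor tensor_map tensor_map_monoid.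

Lemma alg_tensor_sum p :
  exists s : seq (R * (forall j, A j)), p = \sum_(u <- s) u.1 *: alg_pure u.2.
Proof. by exists (repr p); exact: univ_comb. Qed.

Lemma alg_tensor_scaleAr a p q : a *: (p * q) = p * (a *: q).
Proof. by rewrite mulrC alg_tensor_scaleAl mulrC. Qed.

End TensorAlgebra.

Section FiniteSubfamilies.
Context (R : comPzRingType) (I : choiceType) (A : I -> algebra R).
Local Open Scope fset_scope.
Implicit Types phi psi : {fset I}.

(* A_phi, the tensor product over R of the algebras A i for i in phi *)
Definition fset_tensor phi : comPzRingType := alg_tensor (fun i : phi => A (val i)).

Definition fset_tensor_map phi : {rmorphism R -> fset_tensor phi} :=
  tensor_map (fun i : phi => A (val i)).

Definition extend_one phi psi (x : forall i : phi, A (val i)) :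
    forall i : psi, A (val i) :=
  fun i => if (val i \in phi) =P true is ReflectT h then x [` h] else 1.
Arguments extend_one {phi} psi x i.

Definition insert_one phi psi (phi_psi : phi `<=` psi) :
    fset_tensor phi -> fset_tensor psi :=
  let P := tensor (fun i : psi => restr (alg_map (A (val i)))) in
  univ_eval (P := P) (fun x => alg_pure (extend_one psi x)).

Section Insert.
Variables (phi psi : {fset I}) (s : phi `<=` psi).
Let M (i : phi) : lmodType R := restr (alg_map (A (val i))).
Let N (i : psi) : lmodType R := restr (alg_map (A (val i))).

Let extend_dfwith (x : forall i, M i) i (y : M i) :
  extend_one psi (dfwith x y) = dfwith (extend_one psi x) (y : A (val (fincl s i))).
Proof.
apply: functional_extensionality_dep => k.
have [<-|ne] := eqVneq (fincl s i) k.
  rewrite dfwith_in /extend_one; case: eqP => /= [h|]; last first.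
    by case; apply: fsvalP.
  case: i y h => i hi y h; rewrite (bool_irrelevance h hi).
  exact: (dfwith_in (T := M) x y).
rewrite dfwith_out // /extend_one; case: eqP => // h.
by rewrite dfwith_out //; apply: contra_neq ne => ->; apply: val_inj.
Qed.

Let extend_multi : multilinear_map (M := M) (P := tensor N)
  (fun x => alg_pure (extend_one psi x)).
Proof.
move=> x i a y z; rewrite !extend_dfwith.
exact: (pure_multilinear (M := N)).
Qed.

Let lift : {linear tensor M -> tensor N} := univ_lift extend_multi.

Lemma insert_one_pure (x : forall i : phi, A (val i)) :
  insert_one s (alg_pure x) = alg_pure (extend_one psi x).
Proof. exact: (univ_eval_gen _ extend_multi). Qed.

Fact insert_one_zmod : zmod_morphism (insert_one s).
Proof. exact: (linearB lift). Qed.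

Let insertZ a p : insert_one s (a *: (p : tensor M)) = a *: (insert_one s p : tensor N).
Proof. exact: (linearZ_LR lift). Qed.

Let extend_pmul x y :
  extend_one psi (pmul (A := fun i : phi => A (val i)) x y) =
  pmul (A := fun i : psi => A (val i)) (extend_one psi x) (extend_one psi y).
Proof.
apply: functional_extensionality_dep => k; rewrite /pmul /extend_one.
by case: eqP => // _; rewrite mulr1.
Qed.

Fact insert_one_monoid : monoid_morphism (insert_one s).
Proof.
split.
  rewrite -[1]/(alg_pure _) insert_one_pure -[RHS]alg_pure1; congr alg_pure.
  apply: functional_extensionality_dep => k; rewrite /extend_one.
  by case: eqP.
have sum T r (F : T -> fset_tensor phi) :
    insert_one s (\sum_(i <- r) F i) = \sum_(i <- r) insert_one s (F i).
  exact: (linear_sum lift).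
move=> p q.
have [u ->] := alg_tensor_sum p; have [v ->] := alg_tensor_sum q.
rewrite mulr_suml !sum mulr_suml; apply: eq_bigr => a _.
rewrite mulr_sumr sum [in RHS]mulr_sumr; apply: eq_bigr => b _.
rewrite -alg_tensor_scaleAl -alg_tensor_scaleAr -alg_pureM !insertZ.
rewrite -alg_tensor_scaleAl -alg_tensor_scaleAr !insert_one_pure.
by rewrite extend_pmul alg_pureM.
Qed.

HB.instance Definition _ := GRing.isZmodMorphism.Build
  (fset_tensor phi) (fset_tensor psi) (insert_one s) insert_one_zmod.
HB.instance Definition _ := GRing.isMonoidMorphism.Build
  (fset_tensor phi) (fset_tensor psi) (insert_one s) insert_one_monoid.

Lemma insert_one_map a : insert_one s (fset_tensor_map phi a) = fset_tensor_map psi a.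
Proof.
rewrite /fset_tensor_map /= /tensor_map insertZ; congr (_ *: _).
exact: insert_one_monoid.1.
Qed.

End Insert.

End FiniteSubfamilies.

Section Ideals.
Local Open Scope classical_set_scope.
Context (R : comPzRingType).

Definition ideal (I : set R) : Prop :=
  I 0 /\ forall a x y, I x -> I y -> I (a * x + y).

Definition prime_ideal (p : set R) : Prop :=
  [/\ ideal p, ~ p 1 & forall x y, p (x * y) -> p x \/ p y].

Definition maximal_ideal (m : set R) : Prop :=
  [/\ ideal m, ~ m 1 & forall n : set R, ideal n -> ~ n 1 -> m `<=` n -> n = m].

Definition local_ring : Prop := exists! m : set R, maximal_ideal m.

Record spec := Spec { spec_set :> set R; spec_prime : prime_ideal spec_set }.

HB.instance Definition _ := gen_eqMixin spec.
HB.instance Definition _ := gen_choiceMixin spec.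

(* The closed subsets of Spec R are the V(E) = {p | E is contained in p}. *)
Definition zariski_open : set (set spec) :=
  [set U | exists E : set R, U = ~` [set p : spec | E `<=` p]].

Fact zariski_openT : zariski_open setT.
Proof.
exists setT; rewrite eqEsubset; split=> // p _ /(_ 1 I).
by case: p => p [].
Qed.

Fact zariski_openI : setI_closed zariski_open.
Proof.
move=> _ _ [E ->] [F ->].
exists [set z | exists x y, [/\ E x, F y & z = x * y]].
rewrite -setCU; congr (~` _); rewrite eqEsubset; split=> p /=.
  have [[_ pM] _ _] := spec_prime p; have [[p0 _] _ _] := spec_prime p.
  case=> h _ [x [y [Ex Fy ->]]].
    by rewrite mulrC -[_ * _]addr0; apply: pM => //; apply: h.
  by rewrite -[_ * _]addr0; apply: pM => //; apply: h.
move=> h; apply: contrapT => /not_orP[/existsNP[x /not_implyP[Ex px]]].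
move=> /existsNP[y /not_implyP[Fy py]].
have [_ _ pp] := spec_prime p.
by case: (pp x y); first by apply: h; exists x, y.
Qed.

Fact zariski_open_bigU (I : Type) (f : I -> set spec) :
  (forall i, zariski_open (f i)) -> zariski_open (\bigcup_i f i).
Proof.
move=> /choice[E fE]; exists (\bigcup_i E i).
rewrite eqEsubset; split=> p.
  by case=> i _; rewrite fE => h s; apply: h => x Ex; apply: s; exists i.
move=> h; apply: contrapT => n; apply: h => x [i _ Eix].
have : ~ f i p by move=> fip; apply: n; exists i.
by rewrite fE => /contrapT; apply.
Qed.

HB.instance Definition _ := isOpenTopological.Build spec
  zariski_openT zariski_openI zariski_open_bigU.

End Ideals.

Section Morphisms.
Context (R S : comPzRingType) (f : {rmorphism R -> S}).

Definition local_map : Prop := forall (m : set R) (n : set S),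
  maximal_ideal m -> maximal_ideal n -> forall x, m x -> n (f x).

Definition integral_map : Prop := forall s : S,
  exists (n : nat) (c : 'I_n -> R), s ^+ n + \sum_(i < n) f (c i) * s ^+ i = 0.

Definition finite_map : Prop := exists (n : nat) (g : 'I_n -> S),
  forall s : S, exists c : 'I_n -> R, s = \sum_(i < n) f (c i) * g i.

Definition exact_at (M N P : lmodType R) (u : M -> N) (v : N -> P) : Prop :=
  forall y, v y = 0 <-> exists x, u x = y.

Definition faithfully_flat : Prop :=
  forall (M N P : lmodType R) (u : {linear M -> N}) (v : {linear N -> P}),
    exact_at u v <->
    exact_at (tensor2_map (M := restr f) u) (tensor2_map (M := restr f) v).

End Morphisms.

(* Polynomials in n variables over R, as formal sums of monomials. *)
Definition formal_poly (R : comPzRingType) (n : nat) : Type :=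
  seq (R * ('I_n -> nat)).

Definition poly_eval (R S : comPzRingType) (f : {rmorphism R -> S}) (n : nat)
    (x : 'I_n -> S) (p : formal_poly R n) : S :=
  \sum_(t <- p) f t.1 * \prod_(i < n) x i ^+ t.2 i.

(* S is generated over R by x_1, ..., x_n subject to the relations p_1, ..., p_m,
   that is, S = R[X_1, ..., X_n]/(p_1, ..., p_m). *)
Definition presented_by (R S : comPzRingType) (f : {rmorphism R -> S}) (n m : nat)
    (x : 'I_n -> S) (p : 'I_m -> formal_poly R n) : Prop :=
  (forall k, poly_eval f x (p k) = 0) /\
  forall (T : comPzRingType) (g : {rmorphism R -> T}) (y : 'I_n -> T),
    (forall k, poly_eval g y (p k) = 0) ->
    exists h : {rmorphism S -> T},
      [/\ forall a, h (f a) = g a, forall i, h (x i) = y i &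
          forall h' : {rmorphism S -> T},
            (forall a, h' (f a) = g a) -> (forall i, h' (x i) = y i) -> h' =1 h].

Definition finitely_presented (R S : comPzRingType) (f : {rmorphism R -> S}) : Prop :=
  exists (n m : nat) (x : 'I_n -> S) (p : 'I_m -> formal_poly R n), presented_by f x p.

(* EGA IV, 18.5.8: a local ring is henselian if every finite algebra over it is a
   finite product of local rings. *)
Definition henselian (R : comPzRingType) : Prop :=
  local_ring R /\
  forall (B : comPzRingType) (f : {rmorphism R -> B}), finite_map f ->
    exists (n : nat) (C : 'I_n -> comPzRingType) (p : forall i, {rmorphism B -> C i}),
      (forall i, local_ring (C i)) /\
      (forall c : (forall i, C i), exists! b : B, forall i, p i b = c i).

Definition separably_closed (k : fieldType) : Prop :=
  forall p : {poly k}, separable_poly p -> (1 < size p)%N -> exists x, root p x.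

Definition strictly_local (R : comPzRingType) : Prop :=
  henselian R /\
  exists (k : fieldType) (pi : {rmorphism R -> k}),
    (forall y, exists x, pi x = y) /\ separably_closed k.

Definition finite_fppf (R : comPzRingType) (A : algebra R) : Prop :=
  [/\ finite_map (alg_map A), finitely_presented (alg_map A) &
      faithfully_flat (alg_map A)].

Definition alg_iso (R : comPzRingType) (A B : algebra R) : Prop :=
  exists h : {rmorphism A -> B},
    bijective h /\ forall a, h (alg_map A a) = alg_map B a.

Definition connected_fppf (R : comPzRingType) (A : algebra R) : Prop :=
  finite_fppf A /\ connected [set: spec A].

(* A : I -> algebra R is a choice of the set I(R). *)
Definition representatives (R : comPzRingType) (I : choiceType) (A : I -> algebra R) :
    Prop :=
  (forall i, connected_fppf (A i)) /\
  (forall B : algebra R, connected_fppf B -> exists! i, alg_iso B (A i)).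

Definition is_colimit (J : Type) (le : rel J) (F : J -> comPzRingType)
    (t : forall i j, le i j -> {rmorphism F i -> F j})
    (L : comPzRingType) (c : forall j, {rmorphism F j -> L}) : Prop :=
  (forall i j (ij : le i j) x, c j (t i j ij x) = c i x) /\
  forall (T : comPzRingType) (d : forall j, {rmorphism F j -> T}),
    (forall i j (ij : le i j) x, d j (t i j ij x) = d i x) ->
    exists h : {rmorphism L -> T},
      (forall j x, h (c j x) = d j x) /\
      (forall h' : {rmorphism L -> T}, (forall j x, h' (c j x) = d j x) -> h' =1 h).

(* f : R -> S is the canonical map R -> R_+, for some choice of I(R). *)
Definition is_plus (R S : comPzRingType) (f : {rmorphism R -> S}) : Prop :=
  exists (I : choiceType) (A : I -> algebra R),
    representatives A /\
    exists c : forall phi : {fset I}, {rmorphism fset_tensor A phi -> S},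
      is_colimit (le := @fsubset I) (@insert_one R I A) c /\
      forall phi a, c phi (fset_tensor_map A phi a) = f a.

Section Towers.
Context (d : Order.disp_t) (W : orderType d).

Definition zero_ordinal (w : W) : Prop := forall u : W, (w <= u)%O.

Definition successor_of (v w : W) : Prop :=
  (v < w)%O /\ forall u : W, (u < w)%O -> (u <= v)%O.

Definition limit_ordinal (w : W) : Prop :=
  (exists u : W, (u < w)%O) /\
  forall u : W, (u < w)%O -> exists2 v : W, (u < v)%O & (v < w)%O.

(* The direct system R_nu, with nu running through a well-ordered set W of the
   universe, whose elements are identified with the ordinals smaller than the order
   type of W.  An ordinal belongs to the universe exactly when it is the order type
   of such a set, so, over all W, nu takes every value smaller than sigma.  The
   recursion determines the rings R_nu only up to the choice of the sets I(R_nu) and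
   of direct limits; any such choice is allowed here. *)
Record plus_tower (R : comPzRingType) := PlusTower {
  stage :> W -> comPzRingType;
  transition : forall u v : W, (u <= v)%O -> {rmorphism stage u -> stage v};
  transition_id : forall (u : W) (uu : (u <= u)%O) x, transition uu x = x;
  transition_comp : forall (u v w : W) (uv : (u <= v)%O) (vw : (v <= w)%O)
    (uw : (u <= w)%O) x, transition vw (transition uv x) = transition uw x;
  stage_zero : forall w, zero_ordinal w ->
    exists i : {rmorphism R -> stage w}, bijective i;
  stage_succ : forall (v w : W) (vw : (v <= w)%O), successor_of v w ->
    is_plus (transition vw);
  stage_limit : forall w, limit_ordinal w ->
    is_colimit (le := fun u v : {u : W | (u < w)%O} => (val u <= val v)%O)
      (fun u v => @transition (val u) (val v))
      (fun u => transition (ltW (valP u)))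
}.

End Towers.

(* Main.v *)
Require Import Defs.
From HB Require Import structures.
From mathcomp Require Import all_boot all_order all_algebra.
From mathcomp Require Import finmap separable fieldext falgebra ring_quotient zify.
From mathcomp Require Import boolp classical_sets wochoice topology.

(** The statement reduces to three properties of the transition maps, proved together by
    transfinite induction: every stage is local, and the maps between stages are integral
    and faithfully flat.

    Strict locality then comes for free. Every stage is integral over the strictly local
    ring [R_0], and a local ring integral over a strictly local ring is strictly local
    ([strictly_local_integral]). Indeed an algebraic extension of a separably closed field
    is separably closed ([sep_closed_algebraic]). As for the henselian property
    ([henselian_integral]), split a finite algebra by as many orthogonal idempotents as
    possible; each factor has no idempotents left and is integral over a henselian ring,
    hence local ([henselian_integral_local]).

    In the step from a strictly local [R] to [R_+], a connected finite fppf algebra [A] is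
    local ([connected_fppf_local]), free of finite rank over [R]
    ([local_finite_flat_free]), and has [R] as a direct summand. It follows that the tensor
    products [A_phi] are finite projective and have [R] as a direct summand
    ([finite_split_tensor]), so [R_+], their filtered colimit, is integral and faithfully
    flat over [R]. It is local for the following reason. The residue field of
    [A] is purely inseparable over that of [R], so a power [a ^ q] of each [a] in [A] agrees
    with an element of [R] at every closed point of [R_+] ([local_radicial]). The elements
    with that property form a subring, which is all of [R_+] because it contains the images
    of the algebras [A]; and this leaves room for only one closed point ([radicial_local]).

    At limit stages locality and integrality are immediate, and flatness passes to the
    colimit because tensor products commute with filtered colimits ([colimit_tensor_eq0]).

    Two devices are used throughout. Colimits are given by their universal property; mapping
    them to the subring generated by the stages and to a ring of germs recovers their
    description by elements ([colimit_surj], [colimit_eq0]). And faithful flatness is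
    followed through the tower as flatness together with purity, i.e. the injectivity of
    [N / u M -> S (x) (N / u M)], which involves a single map [u] and descends to the stages
    of a colimit as easily as flatness ([flat_pure_faithful]). *)

Set Implicit Arguments.
Unset Strict Implicit.
Unset Printing Implicit Defensive.

Import GRing.Theory.
Local Open Scope ring_scope.
Local Open Scope quotient_scope.

(** * Quotients and subobjects *)

Definition surjective (A B : Type) (f : A -> B) : Prop := forall y, exists x, f x = y.

Lemma ideal_mul (R : comPzRingType) (I : set R) a x : ideal I -> I x -> I (a * x).
Proof. by case=> I0 IM Ix; rewrite -[_ * _]addr0; apply: IM. Qed.

Lemma ideal_add (R : comPzRingType) (I : set R) x y : ideal I -> I x -> I y -> I (x + y).
Proof. by case=> I0 IM Ix Iy; rewrite -[x]mul1r; apply: IM. Qed.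

Definition submodule (R : comPzRingType) (V : lmodType R) (K : set V) : Prop :=
  K 0 /\ forall a x y, K x -> K y -> K (a *: x + y).

Definition subring_set (R : comPzRingType) (X : set R) : Prop :=
  [/\ X 1, forall x y, X x -> X y -> X (x - y) & forall x y, X x -> X y -> X (x * y)].

Section QuotientGroup.
Context (V : zmodType) (K : set V).
Hypotheses (K0 : K 0) (KB : forall x y, K x -> K y -> K (x - y)).

Let pK : {pred V} := fun x => `[< K x >].

Fact subgroup_pred_closed : zmod_closed pK.
Proof. by split=> [|x y /asboolP Kx /asboolP Ky]; apply/asboolP; [|apply: KB]. Qed.

Let zK : zmodClosed V := HB.pack pK (GRing.isZmodClosed.Build V pK subgroup_pred_closed).

Definition group_quot : Type := Quotient.quot zK.
HB.instance Definition _ := GRing.Zmodule.on group_quot.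

Lemma group_quotP : exists p : {additive V -> group_quot},
  surjective p /\ forall x y, p x = p y <-> K (x - y).
Proof.
exists \pi_(Quotient.quot zK); split=> [y|x y].
  by exists (repr (y : Quotient.quot zK)); apply: reprK.
split=> [/eqP|Kxy]; first by rewrite -Quotient.idealrBE => /asboolP.
by apply/eqP; rewrite -Quotient.idealrBE; apply/asboolP.
Qed.

End QuotientGroup.

Lemma quotient_ring (R : comPzRingType) (I : set R) : ideal I ->
  exists (Q : comPzRingType) (p : {rmorphism R -> Q}),
    surjective p /\ forall x, p x = 0 <-> I x.
Proof.
move=> idI.
have IB x y : I x -> I y -> I (x - y).
  by move=> Ix Iy; rewrite addrC -[- y]mulN1r; apply: idI.2.
pose Q := group_quot idI.1 IB; have [p [p_surj pE]] := group_quotP idI.1 IB.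
have [s sK] := boolp.choice p_surj; pose mul u v : Q := p (s u * s v).
have mulE x y : mul (p x) (p y) = p (x * y).
  have [Ix Iy] : I (s (p x) - x) /\ I (s (p y) - y) by split; apply/pE; rewrite sK.
  apply/pE; set x' := s _ in Ix *; set y' := s _ in Iy *.
  have -> : x' * y' - x * y = y' * (x' - x) + x * (y' - y).
    by rewrite !mulrBr [y' * x']mulrC [y' * x]mulrC addrA subrK.
  by apply: ideal_add => //; apply: ideal_mul.
have mulA : associative mul.
  by move=> u v w; rewrite -[u]sK -[v]sK -[w]sK !mulE mulrA.
have mulC : commutative mul by move=> u v; rewrite /mul mulrC.
have mul1 : left_id (p 1) mul by move=> u; rewrite -[u]sK mulE mul1r.
have mulDl : left_distributive mul +%R.
  by move=> u v w; rewrite -[u]sK -[v]sK -[w]sK -raddfD !mulE mulrDl raddfD.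
pose Q' : comPzRingType := HB.pack Q
  (GRing.Zmodule_isComPzRing.Build Q mulA mulC mul1 mulDl).
have pM : @monoid_morphism R Q' p by split=> // x y; rewrite -[RHS]mulE.
pose q : {rmorphism R -> Q'} := HB.pack (p : R -> Q')
  (GRing.isZmodMorphism.Build R Q' p (raddfB p)) (GRing.isMonoidMorphism.Build R Q' p pM).
exists Q', q; split=> [//|x].
by rewrite -[X in I X]subr0 -(rmorph0 q); apply: pE.
Qed.

Lemma quotient_module (R : comPzRingType) (V : lmodType R) (K : set V) : submodule K ->
  exists (Q : lmodType R) (p : {linear V -> Q}), surjective p /\ forall x, p x = 0 <-> K x.
Proof.
move=> subK.
have KB x y : K x -> K y -> K (x - y).
  by move=> Kx Ky; rewrite addrC -scaleN1r; apply: subK.2.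
pose Q := group_quot subK.1 KB; have [p [p_surj pE]] := group_quotP subK.1 KB.
have [s sK] := boolp.choice p_surj; pose scale a u : Q := p (a *: s u).
have scaleE a x : scale a (p x) = p (a *: x).
  apply/pE; rewrite -scalerBr -[_ *: _]addr0; apply: subK.2; last exact: subK.1.
  by apply/pE; rewrite sK.
have scaleA a b u : scale a (scale b u) = scale (a * b) u.
  by rewrite -[u]sK !scaleE scalerA.
have scale1 : left_id 1 scale by move=> u; rewrite /scale scale1r sK.
have scaleDr : right_distributive scale +%R.
  by move=> a u v; rewrite -[u]sK -[v]sK -raddfD !scaleE scalerDr raddfD.
have scaleDl u : {morph scale^~ u : a b / a + b}.
  by move=> a b; rewrite /scale scalerDl raddfD.
pose Q' : lmodType R := HB.pack Q
  (GRing.Zmodule_isLmodule.Build R Q scaleA scale1 scaleDr scaleDl).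
have p_lin : linear (p : V -> Q') by move=> a x y; rewrite [LHS]raddfD -scaleE.
pose q : {linear V -> Q'} := HB.pack (p : V -> Q')
  (GRing.isLinear.Build R V Q' _ p p_lin).
exists Q', q; split=> [//|x].
by rewrite -[X in K X]subr0 -(linear0 q); apply: pE.
Qed.

Lemma subring_exists (R : comPzRingType) (X : set R) : subring_set X ->
  exists (T : comPzRingType) (i : {rmorphism T -> R}),
    injective i /\ forall x, X x <-> exists t, i t = x.
Proof.
case=> X1 XB XM; pose pX : {pred R} := fun x => `[< X x >].
have cX : subring_closed pX.
  split=> [|x y /asboolP Xx /asboolP Xy|x y /asboolP Xx /asboolP Xy]; apply/asboolP => //.
    exact: XB.
  exact: XM.
pose S := {x | pX x}.
pose T' : subComPzRingType pX :=
  HB.pack S (GRing.SubChoice_isSubComPzRing.Build R pX S cX).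
exists (T' : comPzRingType), (val : {rmorphism T' -> R}); split; first exact: val_inj.
move=> x; split=> [/asboolP Xx|[t <-]]; last exact/asboolP/(valP t).
by exists (exist (fun x => pX x) x Xx).
Qed.

Lemma submodule_exists (R : comPzRingType) (V : lmodType R) (X : set V) : submodule X ->
  exists (T : lmodType R) (i : {linear T -> V}),
    injective i /\ forall x, X x <-> exists t, i t = x.
Proof.
case=> X0 XZ; pose pX : {pred V} := fun x => `[< X x >].
have cX : subsemimod_closed pX.
  split; first by split; [exact/asboolP|move=> x y /asboolP Xx /asboolP Xy; apply/asboolP;
    rewrite -[x]scale1r; exact: XZ].
  by move=> a x /asboolP Xx; apply/asboolP; rewrite -[_ *: _]addr0; apply: XZ.
pose S := {x | pX x}.
pose T' : subLmodType pX :=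
  HB.pack S (GRing.SubChoice_isSubLmodule.Build R V pX S cX).
exists (T' : lmodType R), (val : {linear T' -> V}); split; first exact: val_inj.
move=> x; split=> [/asboolP Xx|[t <-]]; last exact/asboolP/(valP t).
by exists (exist (fun x => pX x) x Xx).
Qed.

Lemma rmorphism_ex (A B : comPzRingType) (f : A -> B) :
  (forall x y, f (x - y) = f x - f y) -> f 1 = 1 ->
  (forall x y, f (x * y) = f x * f y) -> {g : {rmorphism A -> B} | g =1 f}.
Proof.
move=> fB f1 fM.
pose g : {rmorphism A -> B} := HB.pack f (GRing.isZmodMorphism.Build A B f fB)
  (GRing.isMonoidMorphism.Build A B f (f1, fM)).
by exists g.
Qed.

Lemma factor_inj (A T L : comPzRingType) (i : {rmorphism T -> L}) (c : {rmorphism A -> L}) :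
  injective i -> (forall y, exists z, i z = c y) ->
  {d : {rmorphism A -> T} | forall y, i (d y) = c y}.
Proof.
move=> i_inj ic.
have [g gE] := boolp.choice ic.
have [||x y|d dE] := @rmorphism_ex A T g.
- by move=> x y; apply: i_inj; rewrite rmorphB !gE rmorphB.
- by apply: i_inj; rewrite gE !rmorph1.
- by apply: i_inj; rewrite rmorphM !gE rmorphM.
by exists d => y; rewrite dE.
Qed.

Lemma factor_surj (A Q B : comPzRingType) (p : {rmorphism A -> Q}) (g : {rmorphism A -> B}) :
  surjective p -> (forall x, p x = 0 -> g x = 0) ->
  {h : {rmorphism Q -> B} | forall x, h (p x) = g x}.
Proof.
move=> p_surj pg.
have [s sE] := boolp.choice p_surj.
have gE x y : p x = p y -> g x = g y.
  by move=> e; apply/eqP; rewrite -subr_eq0 -rmorphB pg // rmorphB e subrr.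
have [||x y|h hE] := @rmorphism_ex Q B (g \o s).
- by move=> x y; rewrite /= -rmorphB; apply: gE; rewrite rmorphB !sE.
- by rewrite -[RHS](rmorph1 g); apply: gE; rewrite rmorph1 sE.
- by rewrite /= -rmorphM; apply: gE; rewrite rmorphM !sE.
by exists h => x; rewrite hE; apply: gE; rewrite sE.
Qed.

(** * Families, germs and filtered colimits *)

Definition ring_family (J : Type) (F : J -> comPzRingType) : Type := forall j, F j.
Definition mod_family (R : comPzRingType) (J : Type) (M : J -> lmodType R) : Type :=
  forall j, M j.

Section RingFamily.
Context (J : Type) (F : J -> comPzRingType).
Local Notation P := (ring_family F).
HB.instance Definition _ := gen_eqMixin P.
HB.instance Definition _ := gen_choiceMixin P.

Let zero : P := fun j => 0.
Let opp (x : P) : P := fun j => - x j.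
Let add (x y : P) : P := fun j => x j + y j.
Let one : P := fun j => 1.
Let mul (x y : P) : P := fun j => x j * y j.
Local Ltac pw := move=> *; apply: functional_extensionality_dep => j;
  rewrite /zero /opp /add /one /mul.
Let addA : associative add. Proof. pw; exact: addrA. Qed.
Let addC : commutative add. Proof. pw; exact: addrC. Qed.
Let add0 : left_id zero add. Proof. pw; exact: add0r. Qed.
Let addN : left_inverse zero opp add. Proof. pw; exact: addNr. Qed.
HB.instance Definition _ := GRing.isZmodule.Build P addA addC add0 addN.
Let mulA : associative mul. Proof. pw; exact: mulrA. Qed.
Let mulC : commutative mul. Proof. pw; exact: mulrC. Qed.
Let mul1 : left_id one mul. Proof. pw; exact: mul1r. Qed.
Let mulDl : left_distributive mul +%R. Proof. pw; exact: mulrDl. Qed.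
HB.instance Definition _ := GRing.Zmodule_isComPzRing.Build P mulA mulC mul1 mulDl.
End RingFamily.

Section ModuleFamily.
Context (R : comPzRingType) (J : Type) (M : J -> lmodType R).
Local Notation P := (mod_family M).
HB.instance Definition _ := gen_eqMixin P.
HB.instance Definition _ := gen_choiceMixin P.

Let zero : P := fun j => 0.
Let opp (x : P) : P := fun j => - x j.
Let add (x y : P) : P := fun j => x j + y j.
Let scale (a : R) (x : P) : P := fun j => a *: x j.
Local Ltac pw := move=> *; apply: functional_extensionality_dep => j;
  rewrite /zero /opp /add /scale.
Let addA : associative add. Proof. pw; exact: addrA. Qed.
Let addC : commutative add. Proof. pw; exact: addrC. Qed.
Let add0 : left_id zero add. Proof. pw; exact: add0r. Qed.
Let addN : left_inverse zero opp add. Proof. pw; exact: addNr. Qed.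
HB.instance Definition _ := GRing.isZmodule.Build P addA addC add0 addN.
Let scaleA a b v : scale a (scale b v) = scale (a * b) v. Proof. pw; exact: scalerA. Qed.
Let scale1 : left_id 1 scale. Proof. pw; exact: scale1r. Qed.
Let scaleDr : right_distributive scale +%R. Proof. pw; exact: scalerDr. Qed.
Let scaleDl v : {morph scale^~ v : a b / a + b}. Proof. pw; exact: scalerDl. Qed.
HB.instance Definition _ := GRing.Zmodule_isLmodule.Build R P scaleA scale1 scaleDr scaleDl.
End ModuleFamily.

Definition directed (J : Type) (le : rel J) : Prop :=
  [/\ exists j : J, True, forall j, le j j,
      forall i j k, le i j -> le j k -> le i k &
      forall i j, exists2 k, le i k & le j k].

Definition eventually (J : Type) (le : rel J) (P : J -> Prop) : Prop :=
  exists j, forall k, le j k -> P k.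

Section Germs.
Context (J : Type) (le : rel J) (leJ : directed le).

Lemma eventually_all (P : J -> Prop) : (forall j, P j) -> eventually le P.
Proof. by case: leJ => -[j _] _ _ _ h; exists j. Qed.

Lemma eventually_mono (P Q : J -> Prop) :
  (forall j, P j -> Q j) -> eventually le P -> eventually le Q.
Proof. by move=> h [j Pj]; exists j => k /Pj /h. Qed.

Lemma eventually_and (P Q : J -> Prop) :
  eventually le P -> eventually le Q -> eventually le (fun j => P j /\ Q j).
Proof.
case: leJ => _ _ tr dir [i Pi] [j Qj]; have [k ik jk] := dir i j.
by exists k => l kl; split; [apply: Pi | apply: Qj]; apply: tr kl.
Qed.

Lemma eventually_ge j : eventually le (le j).
Proof. by exists j. Qed.

Lemma eventually_ex (P : J -> Prop) j : eventually le P -> exists2 k, le j k & P k.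
Proof.
case: leJ => _ rf _ _ ev.
have [k hk] := eventually_and (eventually_ge j) ev.
by exists k; have [] := hk _ (rf k).
Qed.

Lemma germ_ring (F : J -> comPzRingType) :
  exists (T : comPzRingType) (p : {rmorphism ring_family F -> T}),
    forall x, p x = 0 <-> eventually le (fun j => x j = 0).
Proof.
have idI : @ideal (ring_family F) (fun x => eventually le (fun j => x j = 0)).
  split; first exact: eventually_all.
  move=> a x y ex ey; apply: eventually_mono (eventually_and ex ey) => j [xj yj].
  by rewrite -[LHS]/(a j * x j + y j) xj yj mulr0 addr0.
by have [T [p [_ hp]]] := quotient_ring idI; exists T, p.
Qed.

Lemma germ_module (R : comPzRingType) (M : J -> lmodType R) :
  exists (T : lmodType R) (p : {linear mod_family M -> T}),
    forall x, p x = 0 <-> eventually le (fun j => x j = 0).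
Proof.
have idI : @submodule R (mod_family M) (fun x => eventually le (fun j => x j = 0)).
  split; first exact: eventually_all.
  move=> a x y ex ey; apply: eventually_mono (eventually_and ex ey) => j [xj yj].
  by rewrite -[LHS]/(a *: x j + y j) xj yj scaler0 addr0.
by have [T [p [_ hp]]] := quotient_module idI; exists T, p.
Qed.

End Germs.

Section Colimit.
Context (J : Type) (le : rel J) (leJ : directed le) (F : J -> comPzRingType).
Context (t : forall i j, le i j -> {rmorphism F i -> F j}).
Hypothesis t_comp : forall i j k (ij : le i j) (jk : le j k) (ik : le i k) x,
  t jk (t ij x) = t ik x.
Context (L : comPzRingType) (c : forall j, {rmorphism F j -> L}).
Hypothesis colim : is_colimit t c.

Lemma colimit_compat i j (ij : le i j) x : c j (t ij x) = c i x.
Proof. exact: colim.1. Qed.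

(** The elements coming from the stages form a subring [T]. The universal property maps [L]
    to [T], and its uniqueness part makes [L -> T -> L] the identity, so [T = L]. *)
Lemma colimit_surj x : exists j y, c j y = x.
Proof.
have [[j0 _] rf tr dir] := leJ.
have common (j k : J) (y : F j) (z : F k) :
    exists l y' z', c l y' = c j y /\ c l z' = c k z.
  have [l jl kl] := dir j k; exists l, (t jl y), (t kl z).
  by rewrite !colimit_compat.
have [T [i [i_inj iX]]] : exists (T : comPzRingType) (i : {rmorphism T -> L}),
    injective i /\ forall x, (exists j y, c j y = x) <-> exists z, i z = x.
  apply: (subring_exists (X := fun x => exists j y, c j y = x)).
  split=> [|_ _ [j [y <-]] [k [z <-]]|_ _ [j [y <-]] [k [z <-]]].
  - by exists j0, 1; rewrite rmorph1.
  - by have [l [y' [z' [<- <-]]]] := common _ _ y z; exists l, (y' - z'); rewrite rmorphB.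
  - by have [l [y' [z' [<- <-]]]] := common _ _ y z; exists l, (y' * z'); rewrite rmorphM.
have lift j : {d : {rmorphism F j -> T} | forall y, i (d y) = c j y}.
  by apply: factor_inj => // y; apply/iX; exists j, y.
pose d j := sval (lift j).
have dE j y : i (d j y) = c j y by exact: svalP (lift j) y.
have [h [hc _]] : exists h : {rmorphism L -> T}, (forall j x, h (c j x) = d j x) /\
      (forall h' : {rmorphism L -> T}, (forall j x, h' (c j x) = d j x) -> h' =1 h).
  by apply: colim.2 => j k jk y; apply: i_inj; rewrite !dE colimit_compat.
have [h0 [_ h0u]] := colim.2 L c (fun j k jk x => colimit_compat jk x).
apply/iX; exists (h x); rewrite -[i _]/((i \o h) x).
rewrite (h0u (i \o h)) => [|j y]; last by rewrite /= hc dE.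
by rewrite -(h0u idfun).
Qed.

(** An element of [F i] has a germ, given by its images in the later stages. Germs are
    compatible with the transition maps, so they factor through [L]. *)
Lemma colimit_eq0 j x : c j x = 0 -> eventually le (fun k => forall jk : le j k, t jk x = 0).
Proof.
have [T [p pE]] := germ_ring leJ F.
pose push j (x : F j) : ring_family F :=
  fun k => if @idP (le j k) is ReflectT jk then t jk x else 0.
have pushE i y k (ik : le i k) : push i y k = t ik y.
  by rewrite /push; case: {-}_ / idP => // ik'; rewrite (bool_irrelevance ik' ik).
have p_eq (y z : ring_family F) : eventually le (fun k => y k = z k) -> p y = p z.
  move=> ev; apply/eqP; rewrite -subr_eq0 -rmorphB; apply/eqP/pE.
  by apply: eventually_mono ev => k yz; rewrite -[LHS]/(y k - z k) yz subrr.
have dB i : zmod_morphism (fun y => p (push i y)).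
  move=> y z; rewrite -rmorphB; apply: p_eq; exists i => k ik.
  by rewrite -[RHS]/(push i y k - push i z k) !pushE rmorphB.
have dM i : monoid_morphism (fun y => p (push i y)).
  split=> [|y z]; rewrite -?(rmorph1 p) -?rmorphM; apply: p_eq; exists i => k ik.
    by rewrite !pushE rmorph1.
  by rewrite -[RHS]/(push i y k * push i z k) !pushE rmorphM.
pose d i : {rmorphism F i -> T} := HB.pack (fun y => p (push i y))
  (GRing.isZmodMorphism.Build _ _ _ (dB i)) (GRing.isMonoidMorphism.Build _ _ _ (dM i)).
have [h [hc _]] : exists h : {rmorphism L -> T}, (forall j x, h (c j x) = d j x) /\
      (forall h' : {rmorphism L -> T}, (forall j x, h' (c j x) = d j x) -> h' =1 h).
  apply: colim.2 => i k ik y; apply: p_eq; exists k => l kl.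
  have il : le i l by case: leJ => _ _ tr _; apply: tr kl.
  by rewrite !pushE t_comp.
move=> cx0; have /pE ev : p (push j x) = 0 by rewrite -[LHS]/(d j x) -hc cx0 rmorph0.
by apply: eventually_mono ev => k + jk; rewrite pushE.
Qed.

End Colimit.

(** * Maximal ideals, units and local rings *)

Definition invertible (R : comPzRingType) (x : R) : Prop := exists y, x * y = 1.

Section Invertible.
Context (R S : comPzRingType).
Implicit Types x y : R.

Lemma invertible1 : invertible (1 : R). Proof. by exists 1; rewrite mulr1. Qed.

Lemma invertible_mull x y : invertible (x * y) -> invertible x.
Proof. by case=> z xyz; exists (y * z); rewrite mulrA. Qed.

Lemma invertible_rmorph (f : {rmorphism R -> S}) x : invertible x -> invertible (f x).
Proof. by case=> y xy; exists (f y); rewrite -rmorphM xy rmorph1. Qed.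

Lemma invertible_neq0 (K : fieldType) (f : {rmorphism R -> K}) x : invertible x -> f x != 0.
Proof.
case=> y xy; apply/eqP => fx; have := rmorph1 f.
by rewrite -xy rmorphM fx mul0r => /esym/eqP; rewrite oner_eq0.
Qed.

Lemma ideal_invertible (I : set R) x : ideal I -> I x -> invertible x -> I 1.
Proof. by move=> idI Ix [y <-]; rewrite mulrC; apply: ideal_mul. Qed.

Lemma principal_ideal x : ideal (fun y => exists a, y = a * x).
Proof.
split; first by exists 0; rewrite mul0r.
by move=> a _ _ [b ->] [c ->]; exists (a * b + c); rewrite mulrDl mulrA.
Qed.

End Invertible.

Lemma maximal_ideal_exists (R : comPzRingType) (I : set R) : ideal I -> ~ I 1 ->
  exists m, maximal_ideal m /\ (I `<=` m)%classic.
Proof.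
(* Joining [I] to each set makes the empty chain harmless. *)
move=> idI I1; pose P X := ideal (X `|` I)%classic /\ ~ (X `|` I)%classic 1.
have [F FP totF|A [[idA A1] Amax]] := @Zorn_bigcup R P.
  have up (X Y : set R) : F X -> F Y ->
      exists2 Z, F Z & (X `<=` Z)%classic /\ (Y `<=` Z)%classic.
    by move=> FX FY; have [XY|YX] := totF _ _ FX FY; [exists Y|exists X] => //; split.
  have up2 x y : (\bigcup_(X in F) X `|` I)%classic x -> (\bigcup_(X in F) X `|` I)%classic y ->
      (I x /\ I y) \/ exists2 Z, F Z & (Z `|` I)%classic x /\ (Z `|` I)%classic y.
    case=> [[X FX Xx]|Ix] [[Y FY Yy]|Iy].
    - have [Z FZ [XZ YZ]] := up _ _ FX FY; right; exists Z => //.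
      by split; left; [apply: XZ|apply: YZ].
    - by right; exists X => //; split; [left|right].
    - by right; exists Y => //; split; [right|left].
    - by left.
  split; first (split; first by right; exact: idI.1).
    move=> a x y hx hy; case: (up2 _ _ hx hy) => [[Ix Iy]|[Z FZ [Zx Zy]]].
      by right; apply: idI.2.
    have [[_ ZM] _] := FP Z FZ.
    by case: (ZM a _ _ Zx Zy) => ?; [left; exists Z|right].
  move=> [|//] [X FX X1]; have [_ nX] := FP X FX.
  by apply: nX; left.
exists (A `|` I)%classic; split; last by move=> x; right.
split=> // n idn n1 An; rewrite eqEsubset; split=> // x nx; apply: contrapT => Ax.
have nI : (n `|` I)%classic = n by apply/setUidPl => y Iy; apply: An; right.
apply: (Amax n); last by rewrite /P nI.
by split=> [y Ay|/(_ x nx) Ax']; [apply: An; left|apply: Ax; left].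
Qed.

Lemma residue_field (R : comPzRingType) (m : set R) : maximal_ideal m ->
  exists (K : fieldType) (rho : {rmorphism R -> K}),
    surjective rho /\ forall x, rho x = 0 <-> m x.
Proof.
case=> idm m1 mmax; have [Q [p [p_surj pm]]] := quotient_ring idm.
have Q1 : (1 : Q) != 0 by apply/eqP; rewrite -(rmorph1 p) => /pm.
have Qinv (y : Q) : exists z, if y == 0 then z = 0 else z * y = 1.
  case: eqP => [_|y0]; first by exists 0.
  have [x xy] := p_surj y; rewrite -{y}xy in y0 *.
  pose n := fun z => exists a b, m b /\ z = a * x + b.
  have idn : ideal n.
    split; first by exists 0, 0; rewrite mul0r addr0; split=> //; exact: idm.1.
    move=> c _ _ [a [b [mb ->]]] [a' [b' [mb' ->]]].
    exists (c * a + a'), (c * b + b'); split; first by apply: idm.2.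
    by rewrite mulrDr !mulrDl addrACA mulrA.
  have mn : (m `<=` n)%classic by move=> b mb; exists 0, b; rewrite mul0r add0r.
  case: (pselect (n 1)) => [[a [b [mb ab]]]|n1].
    exists (p a); rewrite -rmorphM -(rmorph1 p) ab rmorphD.
    by have/pm -> := mb; rewrite addr0.
  case: y0; apply/pm; rewrite -(mmax n idn n1 mn).
  by exists 1, 0; rewrite mul1r addr0; split=> //; exact: idm.1.
have [inv invE] := boolp.choice Qinv.
pose Qn : comNzRingType := HB.pack (GRing.ComPzRing.sort Q)
  (GRing.PzSemiRing_isNonZero.Build Q Q1).
have mulVf (x : Qn) : x != 0 -> (inv x : Qn) * x = 1.
  by move=> x0; have := invE x; rewrite ifN.
have inv0 : inv 0 = 0 :> Qn by have := invE 0; rewrite eqxx.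
pose K : fieldType := HB.pack (GRing.ComNzRing.sort Qn)
  (GRing.ComNzRing_isField.Build Qn mulVf inv0).
exists K, p; split; [exact: p_surj|exact: pm].
Qed.

(** From here on a closed point of the spectrum is a surjective ring morphism onto a field
    rather than its kernel, so that what happens there is computed in a field. *)
Lemma not_invertible_point (R : comPzRingType) (x : R) : ~ invertible x ->
  exists (K : fieldType) (rho : {rmorphism R -> K}), surjective rho /\ rho x = 0.
Proof.
move=> ux; have [|m [mm xm]] := maximal_ideal_exists (principal_ideal x).
  by case=> y y1; apply: ux; exists y; rewrite mulrC.
have [K [rho [rho_surj rhom]]] := residue_field mm.
by exists K, rho; split=> //; apply/rhom/xm; exists 1; rewrite mul1r.
Qed.

Lemma invertible_point (R : comPzRingType) (x : R) :
  (forall (K : fieldType) (rho : {rmorphism R -> K}), surjective rho -> rho x != 0) ->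
  invertible x.
Proof.
move=> h; apply: contrapT => /not_invertible_point[K [rho [s /eqP]]].
by apply/negP/h.
Qed.

Lemma kernel_maximal (R : comPzRingType) (K : fieldType) (rho : {rmorphism R -> K}) :
  surjective rho -> maximal_ideal (fun x => rho x = 0).
Proof.
move=> rho_surj; split.
- split; first exact: rmorph0.
  by move=> a x y hx hy; rewrite rmorphD rmorphM hx hy mulr0 addr0.
- by rewrite rmorph1 => /eqP; rewrite oner_eq0.
move=> n idn n1 kn; rewrite eqEsubset; split=> // x nx.
apply/eqP; apply: contra_notT n1 => rx.
have [y yE] := rho_surj (rho x)^-1.
have : rho (1 - y * x) = 0 by rewrite rmorphB rmorphM rmorph1 yE mulVf ?subrr.
by move=> /kn h; rewrite -[1](subrK (y * x)); apply: ideal_add => //; apply: ideal_mul.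
Qed.

Section Local.
Context (R : comPzRingType).

Lemma maximal_not_invertible (m : set R) x : maximal_ideal m -> m x -> ~ invertible x.
Proof. by case=> idm m1 _ mx /(ideal_invertible idm mx). Qed.

(** The criterion that is checked in practice: it makes the non-invertible elements an
    ideal, for if [a x + y] is invertible with inverse [z] then [1 - a x z = y z]. *)
Lemma local_ringP : local_ring R <->
  (1 : R) <> 0 /\ forall x : R, invertible x \/ invertible (1 - x).
Proof.
split=> [[m [mm mU]]|[R1 Rx]].
  have [idm m1 _] := mm; split; first by move=> h; apply: m1; rewrite h; exact: idm.1.
  have mI x : ~ invertible x -> m x.
    move=> /not_invertible_point[K [rho [rho_surj rx]]].
    by rewrite (mU _ (kernel_maximal rho_surj)).
  move=> x; apply: contrapT => /not_orP[/mI mx /mI mx'].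
  by apply: m1; rewrite -[1](subrK x); apply: ideal_add.
have idm : ideal (fun x : R => ~ invertible x).
  split; first by case=> y; rewrite mul0r => /esym.
  move=> a x y nx ny [z xyz]; case: (Rx (a * x * z)).
    by move/invertible_mull; rewrite mulrC => /invertible_mull.
  rewrite -xyz mulrDl addrAC subrr add0r; by move/invertible_mull.
have m1 : ~ ~ invertible (1 : R) by apply; exact: invertible1.
exists (fun x => ~ invertible x); split=> [|n mn].
  split=> // n idn n1 mn; rewrite eqEsubset; split=> // x nx.
  by move/(ideal_invertible idn nx).
have [idn n1 nmax] := mn; apply: nmax => // x nx.
exact: maximal_not_invertible nx.
Qed.

Hypothesis loc : local_ring R.

Lemma local_neq0 : (1 : R) <> 0. Proof. by have /local_ringP[] := loc. Qed.

Lemma local_point : exists (K : fieldType) (rho : {rmorphism R -> K}), surjective rho.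
Proof.
have [|K [rho [s _]]] := @not_invertible_point R 0; last by exists K, rho.
by case=> y; rewrite mul0r => /esym/local_neq0.
Qed.

Lemma local_kernel (K : fieldType) (rho : {rmorphism R -> K}) x :
  surjective rho -> rho x = 0 <-> ~ invertible x.
Proof.
move=> s; split=> [rx /(invertible_neq0 rho)/eqP//|nx]; apply/eqP.
apply: contraT => rx; case: nx; have [y yE] := s (rho x)^-1.
have /local_ringP[_ /(_ (x * y))] := loc.
case=> [/invertible_mull//|/(invertible_neq0 rho)/eqP].
by case; rewrite rmorphB rmorph1 rmorphM yE divff ?subrr.
Qed.

Lemma local_maximalP (m : set R) : maximal_ideal m -> forall x, m x <-> ~ invertible x.
Proof.
move=> mm x; have [K [rho [s rm]]] := residue_field mm.
by rewrite -(local_kernel x s); symmetry.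
Qed.

End Local.

(** * Integral and finite ring extensions *)

Definition integral_elt (R S : comPzRingType) (f : {rmorphism R -> S}) (s : S) : Prop :=
  exists (n : nat) (c : 'I_n -> R), s ^+ n + \sum_(i < n) f (c i) * s ^+ i = 0.

Lemma integral_eltP (R S : comNzRingType) (f : {rmorphism R -> S}) (s : S) :
  integral_elt f s <-> integralOver f s.
Proof.
split=> [[n [c sc]]|[p p_monic /rootP ps]].
  pose q : {poly R} := \poly_(i < n) (if insub i is Some j then c j else 0).
  have size_q : (size q < (size ('X^n : {poly R})))%N by rewrite size_polyXn ltnS size_poly.
  exists ('X^n + q); first by rewrite monicE lead_coefDl // lead_coefXn.
  apply/rootP; rewrite rmorphD /= map_polyXn hornerD hornerXn -[RHS]sc; congr (_ + _).
  rewrite (@horner_coef_wide _ n) ?(leq_trans (size_poly _ _)) ?size_poly //.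
  by apply: eq_bigr => i _; rewrite coef_map coef_poly ltn_ord valK.
have [n size_p] : exists n, size p = n.+1.
  by exists (size p).-1; rewrite prednK // lt0n size_poly_eq0 monic_neq0.
have lead1 : p`_n = 1 by rewrite -[RHS](monicP p_monic) lead_coefE size_p.
exists n, (fun i => p`_i); rewrite -[RHS]ps horner_coef size_map_poly_id0; last first.
  by rewrite (monicP p_monic) rmorph1 oner_neq0.
rewrite size_p [RHS]big_ord_recr /= [RHS]addrC; congr (_ + _).
  by rewrite coef_map /= lead1 rmorph1 mul1r.
by apply: eq_bigr => i _; rewrite coef_map.
Qed.

Lemma integral_elt_rmorph (R R' S S' : comPzRingType) (f : {rmorphism R -> S})
    (f' : {rmorphism R' -> S'}) (p : R -> R') (g : {rmorphism S -> S'}) s :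
  (forall x, f' (p x) = g (f x)) -> integral_elt f s -> integral_elt f' (g s).
Proof.
move=> fp [n [c sc]]; exists n, (p \o c).
rewrite -[RHS](rmorph0 g) -sc rmorphD rmorphXn rmorph_sum /=; congr (_ + _).
by apply: eq_bigr => i _; rewrite rmorphM rmorphXn fp.
Qed.

Lemma zero_ring (R : comPzRingType) (x : R) : (1 : R) = 0 -> x = 0.
Proof. by move=> h; rewrite -[x]mul1r h mul0r. Qed.

Lemma integral_zero_ring (R S : comPzRingType) (f : {rmorphism R -> S}) :
  (1 : S) = 0 -> integral_map f.
Proof.
by move=> h s; exists 0, (fun=> 0); apply: zero_ring.
Qed.

(** Polynomials and characteristic polynomials want coefficients in a ring where [1 != 0];
    this is such a ring on the same carrier, with the same operations by conversion. *)
Definition nontrivial (R : comPzRingType) (R1 : (1 : R) != 0) : comNzRingType :=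
  HB.pack (GRing.ComPzRing.sort R) (GRing.PzSemiRing_isNonZero.Build R R1).

Lemma rmorph_nontrivial (R S : comPzRingType) (f : {rmorphism R -> S}) :
  (1 : S) != 0 -> (1 : R) != 0.
Proof. by apply: contra_neq => h; rewrite -(rmorph1 f) h rmorph0. Qed.

Lemma integral_trans (R S T : comPzRingType) (f : {rmorphism R -> S})
    (g : {rmorphism S -> T}) (h : {rmorphism R -> T}) :
  (forall x, h x = g (f x)) -> integral_map f -> integral_map g -> integral_map h.
Proof.
move=> hE fI gI; have [T1|T1] := eqVneq (1 : T) 0; first exact: integral_zero_ring.
have S1 := rmorph_nontrivial g T1; have R1 := rmorph_nontrivial f S1.
pose R' := nontrivial R1; pose S' := nontrivial S1; pose T' := nontrivial T1.
pose f' : {rmorphism R' -> S'} := f; pose g' : {rmorphism S' -> T'} := g.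
pose h' : {rmorphism R' -> T'} := h.
move=> u; apply/(@integral_eltP R' T' h').
have /(@integral_eltP S' T' g')[p p_monic pu] := gI u.
apply: (@integral_root_monic R' T' h' u (map_poly g' p)); [exact: monic_map|exact: pu|].
apply/integral_poly => i; rewrite coef_map.
have /(@integral_eltP R' S' f')[q q_monic /rootP qs] := fI p`_i.
exists q => //; apply/rootP; rewrite -(rmorph0 g') -[0 in RHS]qs -horner_map -map_poly_comp.
by congr (_.[_]); apply: eq_map_poly => x; apply: hE.
Qed.

(** Cayley-Hamilton: if [A] is a matrix of the multiplication by [s] on the generators, then
    [det (s - A)] kills all generators, hence [1]. *)
Lemma finite_integral (R S : comPzRingType) (f : {rmorphism R -> S}) :
  finite_map f -> integral_map f.
Proof.
case=> n [g gS]; have [S1|S1] := eqVneq (1 : S) 0; first exact: integral_zero_ring.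
have R1 := rmorph_nontrivial f S1.
pose R' := nontrivial R1; pose S' := nontrivial S1; pose f' : {rmorphism R' -> S'} := f.
move=> s; apply/(@integral_eltP R' S' f').
have [c cE] := boolp.choice (fun i => gS (s * g i)).
have [u uE] := gS 1.
pose A : 'M[R']_n := \matrix_(i, j) c i j.
pose B : 'M[S']_n := (s : S')%:M - map_mx f' A; pose v : 'cV[S']_n := \col_i g i.
have Bv : B *m v = 0.
  apply/colP => i; rewrite mulmxBl mul_scalar_mx !mxE cE; apply/eqP; rewrite subr_eq0.
  by apply/eqP; apply: eq_bigr => j _; rewrite !mxE.
have detv i : \det B * v i 0 = 0.
  have : \adj B *m B *m v = 0 by rewrite -mulmxA Bv mulmx0.
  by rewrite mul_adj_mx mul_scalar_mx => /colP/(_ i); rewrite !mxE.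
exists (char_poly A); first exact: char_poly_monic.
apply/rootP.
have <- : \det B = 0.
  rewrite -[LHS]mulr1 [X in _ * X]uE mulr_sumr big1 // => i _.
  by rewrite mulrCA; have := detv i; rewrite mxE => ->; rewrite mulr0.
rewrite -horner_evalE -2!det_map_mx; congr (\det _).
rewrite raddfB /= map_scalar_mx; apply/matrixP=> i j.
by rewrite !mxE raddfB raddfMn /= map_polyX map_polyC /horner_eval !hornerE.
Qed.

Lemma integral_surj (R S Q : comPzRingType) (f : {rmorphism R -> S}) (p : {rmorphism S -> Q})
    (h : {rmorphism R -> Q}) :
  (forall x, h x = p (f x)) -> surjective p -> integral_map f -> integral_map h.
Proof.
move=> hE p_surj fI y; have [s <-] := p_surj y.
exact: (integral_elt_rmorph (p := id)) hE (fI s).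
Qed.

(** If [f x] were nonzero at the point, its inverse [y] would be integral; clearing
    denominators in the equation of [y] gives [1 + x z] vanishing at the point. *)
Lemma integral_lying_over (A B : comPzRingType) (f : {rmorphism A -> B}) (K : fieldType)
    (rho : {rmorphism B -> K}) x :
  local_ring A -> integral_map f -> surjective rho -> ~ invertible x -> rho (f x) = 0.
Proof.
move=> locA fI rho_surj nx; apply/eqP; apply: contraT => rx.
have [y yE] := rho_surj (rho (f x))^-1; have [n [c]] := fI y.
move/(congr1 rho); rewrite rmorph0 => /(congr1 ( *%R (rho (f x) ^+ n))).
rewrite mulr0 rmorphD rmorphXn yE mulrDr exprVn divff ?expf_neq0 // rmorph_sum mulr_sumr.
pose z := \sum_(i < n) c i * x ^+ (n - i).-1 .
have -> : \sum_(i < n) rho (f x) ^+ n * rho (f (c i) * y ^+ i) = rho (f (x * z)).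
  rewrite mulr_sumr !rmorph_sum; apply: eq_bigr => i _.
  rewrite mulrCA -exprS prednK ?subn_gt0 // !rmorphM !rmorphXn yE exprVn mulrCA; congr (_ * _).
  by rewrite -expfB // ltnW.
rewrite -(rmorph1 rho) -(rmorph1 f) -!rmorphD.
have [_ /(_ (- (x * z)))] := (local_ringP A).1 locA; case=> [|h].
  by rewrite -mulrN => /invertible_mull.
by rewrite opprK in h; move=> e; have /eqP := invertible_neq0 (rho \o f) h.
Qed.

Lemma residue_rmorphism (R B : comPzRingType) (f : {rmorphism R -> B}) (k K : fieldType)
    (pi : {rmorphism R -> k}) (rho : {rmorphism B -> K}) :
  local_ring R -> surjective pi -> integral_map f -> surjective rho ->
  exists h : {rmorphism k -> K}, forall x, h (pi x) = rho (f x).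
Proof.
move=> locR pi_surj f_int rho_surj.
have [|h hE] := @factor_surj _ _ _ pi (rho \o f) pi_surj; last by exists h.
by move=> x /(local_kernel locR _ pi_surj); apply: integral_lying_over f_int rho_surj.
Qed.

(** * Henselian rings *)

(** [C] is the subring [R[b]], spanned by the powers of [b] below the degree [n] of an
    equation of [b]. *)
Lemma integral_adjoin (R B : comPzRingType) (f : {rmorphism R -> B}) (b : B) :
  integral_elt f b ->
  exists (C : comPzRingType) (g : {rmorphism R -> C}) (i : {rmorphism C -> B}),
    [/\ finite_map g, forall x, i (g x) = f x & exists c, i c = b].
Proof.
case=> n [c bc]; pose M x := exists d : 'I_n -> R, x = \sum_(i < n) f (d i) * b ^+ i.
have MD x y : M x -> M y -> M (x + y).
  move=> [d ->] [d' ->]; exists (fun i => d i + d' i); rewrite -big_split /=.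
  by apply: eq_bigr => i _; rewrite rmorphD mulrDl.
have MZ a x : M x -> M (f a * x).
  move=> [d ->]; exists (fun i => a * d i); rewrite mulr_sumr.
  by apply: eq_bigr => i _; rewrite rmorphM mulrA.
have M0 : M 0.
  by exists (fun=> 0); rewrite big1 // => i _; rewrite rmorph0 mul0r.
have Msum (I : finType) (F : I -> B) : (forall i, M (F i)) -> M (\sum_i F i).
  by move=> MF; elim/big_ind: _.
have Mpow k : (k <= n)%N -> M (b ^+ k).
  rewrite leq_eqVlt => /predU1P[->|kn].
    exists (fun i => - c i); apply/eqP; rewrite -subr_eq0 -sumrN -[X in _ == X]bc.
    apply/eqP; congr (_ + _); apply: eq_bigr => i _.
    by rewrite rmorphN mulNr opprK.
  exists (fun i => (i == Ordinal kn)%:R); rewrite (bigD1 (Ordinal kn)) //= eqxx rmorph1 mul1r.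
  by rewrite big1 ?addr0 // => i /negPf ->; rewrite rmorph0 mul0r.
have Mb x : M x -> M (b * x).
  move=> [d ->]; rewrite mulr_sumr; apply: Msum => i.
  by rewrite mulrCA -exprS; apply/MZ/Mpow.
have Mbn k x : M x -> M (b ^+ k * x).
  by move=> Mx; elim: k => [|k IHk]; rewrite ?mul1r // exprS -mulrA; apply: Mb.
have M1 : M 1 by exact: (Mpow 0).
have Mf a : M (f a) by rewrite -[f a]mulr1; apply: MZ.
have MM x y : M x -> M y -> M (x * y).
  move=> [d ->] My; rewrite mulr_suml; apply: Msum => i.
  by rewrite -mulrA; apply/MZ/Mbn.
have subM : subring_set M.
  split=> // x y Mx My; apply: MD => //.
  by rewrite -mulN1r -(rmorph1 f) -rmorphN; apply: MZ.
have [C [i [i_inj MC]]] := subring_exists subM.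
have [g gE] : {g : {rmorphism R -> C} | forall y, i (g y) = f y}.
  by apply: factor_inj => // y; apply/MC/Mf.
have [u uE] := boolp.choice (fun k : 'I_n => (MC _).1 (Mpow _ (ltnW (ltn_ord k)))).
have [v vE] : exists v, i v = b by apply/MC; rewrite -[b]mulr1; apply: Mb.
exists C, g, i; split=> //; last by exists v.
exists n, u => s; have [d dE] := (MC (i s)).2 (ex_intro _ s erefl).
exists d; apply: i_inj; rewrite dE rmorph_sum /=.
by apply: eq_bigr => k _; rewrite rmorphM gE uE.
Qed.

(** The finite subalgebra generated by [b] is a product of local rings; since
    [B] has no idempotents, exactly one of the factors survives in [B], and [b] or
    [1 - b] is invertible there. *)
Lemma henselian_integral_local (R B : comPzRingType) (f : {rmorphism R -> B}) :
  henselian R -> integral_map f -> (1 : B) <> 0 ->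
  (forall e : B, e * e = e -> e = 0 \/ e = 1) -> local_ring B.
Proof.
case=> _ hens fI B1 idem; apply/local_ringP; split=> // b.
have [C [g [i [g_fin ig [c ic]]]]] := integral_adjoin (fI b).
have [n [D [p [D_loc p_bij]]]] := hens C g g_fin.
have p_inj (x y : C) : (forall k, p k x = p k y) -> x = y.
  by move=> xy; have [z [_ zU]] := p_bij (p^~ x); rewrite -(zU x) // -(zU y).
have p_surj (u : forall k, D k) : exists x, forall k, p k x = u k.
  by have [z [zE _]] := p_bij u; exists z.
have [e eE] : exists e : 'I_n -> C, forall j k, p k (e j) = (k == j)%:R.
  suff /boolp.choice[e eE] : forall j, exists x, forall k, p k x = (k == j)%:R by exists e.
  by move=> j; apply: p_surj.
have e_idem j : i (e j) = 0 \/ i (e j) = 1.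
  apply: idem; rewrite -rmorphM; congr (i _); apply: p_inj => k.
  by rewrite rmorphM eE -natrM mulnb andbb.
have e_sum : \sum_j e j = 1.
  apply: p_inj => k; rewrite rmorph_sum rmorph1 (bigD1 k) //= eE eqxx big1 ?addr0 // => j.
  by rewrite eE eq_sym => /negPf ->.
have [j ej] : exists j, i (e j) = 1.
  apply: contrapT => /forallNP e0; apply: B1.
  rewrite -(rmorph1 i) -e_sum rmorph_sum big1 // => j _.
  by have [//|/e0] := e_idem j.
have main x : invertible (p j x) -> invertible (i x).
  case=> u xu; have [d dE] := p_surj (dfwith (fun k => 0 : D k) u).
  exists (i d); rewrite -rmorphM -ej; congr (i _); apply: p_inj => k.
  rewrite rmorphM dE eE; have [<-|jk] := eqVneq j k.
    by rewrite dfwith_in xu.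
  by rewrite dfwith_out // mulr0.
have /local_ringP[_ /(_ (p j c))] := D_loc j; rewrite -ic.
case=> [/main|h]; [by left|right; rewrite -(rmorph1 i) -rmorphB].
by apply: main; rewrite rmorphB rmorph1.
Qed.

Section OrthogonalIdempotents.
Context (B : comPzRingType).

Definition idempotent_decomposition n (e : 'I_n -> B) : Prop :=
  [/\ forall i, e i * e i = e i, forall i j, i != j -> e i * e j = 0,
      \sum_i e i = 1 & forall i, e i <> 0].

(** The idempotent [e i] is replaced by the orthogonal pair [e i * x], [e i * (1 - x)]. *)
Lemma idempotent_split n (e : 'I_n -> B) i x :
  idempotent_decomposition e ->
  e i * (x * x) = e i * x -> e i * x <> 0 -> e i * (1 - x) <> 0 ->
  exists e' : 'I_n.+1 -> B, idempotent_decomposition e'.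
Proof.
case=> [ee eo es e0] xx x0 x1.
pose s j := if j == i then x else 1.
have ss j : e j * s j * (e j * s j) = e j * s j.
  rewrite mulrACA ee /s; case: eqP => [->//|_]; by rewrite !mulr1.
have x1E : e i * ((1 - x) * (1 - x)) = e i * (1 - x).
  rewrite mulrBl mul1r [X in _ - X]mulrBr mulr1 [LHS]mulrBr [X in _ - X]mulrBr.
  by rewrite xx subrr subr0.
have xo : e i * x * (e i * (1 - x)) = 0.
  by rewrite mulrACA ee mulrBr mulr1 mulrBr xx subrr.
(* Index 0 is the new idempotent; [s] cuts the old [e i] down to [e i * x]. *)
exists (fun k => if unlift ord0 k is Some j then e j * s j else e i * (1 - x)).
have oN j : e j * s j * (e i * (1 - x)) = 0.
  have [->|ji] := eqVneq j i; first by rewrite /s eqxx.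
  by rewrite mulrACA eo ?mul0r.
split=> [k|k l|| k].
- by case: unliftP => [j|] _; rewrite ?ss // mulrACA ee x1E.
- case: unliftP => [j|] ->; case: unliftP => [j'|] -> kl.
  + by rewrite mulrACA eo ?mul0r //; apply: contra_neq kl => ->.
  + exact: oN.
  + by rewrite mulrC oN.
  + by rewrite eqxx in kl.
- rewrite big_ord_recl unlift_none; under eq_bigr do rewrite liftK.
  rewrite -[RHS]es [RHS](bigD1 i) //= [X in _ + X](bigD1 i) //=.
  rewrite addrA {1}/s eqxx -mulrDr subrK mulr1.
  by congr (_ + _); apply: eq_bigr => j /negPf ji; rewrite /s ji mulr1.
- case: unliftP => [j|] _ //; rewrite /s; case: eqP => [->//|_].
  by rewrite mulr1; apply: e0.
Qed.

(** Modulo the maximal ideal of [S], more than [N] orthogonal idempotents would be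
    linearly dependent over the residue field; multiplying a dependency by one of
    the idempotents puts that idempotent into every maximal ideal. *)
Lemma idempotent_bound (S : comPzRingType) (f : {rmorphism S -> B}) N (g : 'I_N -> B)
    n (e : 'I_n -> B) :
  local_ring S ->
  (forall s : B, exists c : 'I_N -> S, s = \sum_(i < N) f (c i) * g i) ->
  idempotent_decomposition e -> (n <= N)%N.
Proof.
move=> locS gS [ee eo es e0]; rewrite leqNgt; apply/negP => Nn.
have f_int : integral_map f by apply: finite_integral; exists N, g.
have [a aE] := boolp.choice (fun i => gS (e i)).
have [K [rho rho_surj]] := local_point locS.
pose A := \matrix_(i < n, j < N) rho (a i j).
have : kermx A != 0.
  by rewrite kermx_eq0 -row_leq_rank -ltnNge (leq_ltn_trans (rank_leq_col A)).
case/rowV0Pn => v /sub_kermxP vA /rV0Pn[i0 vi0].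
have [w wE] := boolp.choice (fun i => rho_surj (v 0 i)).
have wz j : ~ invertible (\sum_i w i * a i j).
  apply/(local_kernel locS _ rho_surj); rewrite rmorph_sum /=.
  move/rowP/(_ j): vA; rewrite !mxE => vA; rewrite -[RHS]vA.
  by apply: eq_bigr => i _; rewrite rmorphM wE !mxE.
have we : f (w i0) * e i0 = e i0 * \sum_j f (\sum_i w i * a i j) * g j.
  have -> : \sum_j f (\sum_i w i * a i j) * g j = \sum_i f (w i) * e i.
    under eq_bigr do rewrite rmorph_sum mulr_suml.
    rewrite exchange_big; apply: eq_bigr => i _; rewrite [in RHS]aE mulr_sumr.
    by apply: eq_bigr => j _; rewrite rmorphM mulrA.
  rewrite mulr_sumr (bigD1 i0) //= mulrCA ee big1 ?addr0 // => i ne.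
  by rewrite mulrCA eo 1?eq_sym // mulr0.
have [u eu] : invertible (1 - e i0).
  apply: invertible_point => K' tau tau_surj.
  have : tau (f (w i0)) != 0.
    apply: (invertible_neq0 (tau \o f)); apply: contrapT => /(local_kernel locS _ rho_surj).
    by rewrite wE; apply/eqP.
  move=> tw; move/(congr1 tau): we.
  rewrite !rmorphM rmorph_sum big1 ?mulr0 => [|j _]; last first.
    by rewrite rmorphM (integral_lying_over _ f_int) ?mul0r.
  by move/eqP; rewrite mulf_eq0 (negPf tw) rmorphB rmorph1 => /eqP ->; rewrite subr0 oner_neq0.
by apply: (e0 i0); rewrite -[LHS]mulr1 -eu mulrA mulrBr mulr1 ee subrr mul0r.
Qed.

End OrthogonalIdempotents.

(** Take a decomposition of [1] in [B] into as many orthogonal idempotents as possible: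
    the factors it cuts out have no idempotents, hence are local. *)
Lemma henselian_integral (R S : comPzRingType) (f : {rmorphism R -> S}) :
  henselian R -> integral_map f -> local_ring S -> henselian S.
Proof.
move=> hensR fI locS; split=> // B g g_fin; have [N [gen genB]] := g_fin.
pose P n := `[< exists e : 'I_n -> B, idempotent_decomposition e >].
have P_ex : exists n, P n.
  have [B1|/eqP B1] := eqVneq (1 : B) 0.
    by exists 0; apply/asboolP; exists (fun=> 0); split=> [[]//|[]//||[]//]; rewrite big_ord0.
  exists 1; apply/asboolP; exists (fun=> 1); split=> [i|i j|| i //].
  - by rewrite mulr1.
  - by rewrite !ord1.
  - by rewrite big_ord1.
have P_bound n : P n -> (n <= N)%N.
  by move/asboolP => [e]; apply: idempotent_bound genB.
case: (ex_maxnP P_ex P_bound) => n /asboolP[e eP] n_max.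
have [ee eo es e0] := eP.
have idI i : ideal (fun x => e i * x = 0).
  split; first by rewrite mulr0.
  by move=> a x y ex ey; rewrite mulrDr mulrCA ex ey mulr0 addr0.
have Q i : {C : comPzRingType & {p : {rmorphism B -> C} |
    surjective p /\ forall x, p x = 0 <-> e i * x = 0}}.
  by have [C /cid[p]] := cid (quotient_ring (idI i)); exists C, p.
pose C i := tag (Q i); pose p i : {rmorphism B -> C i} := sval (tagged (Q i)).
have p_surj i : surjective (p i) by exact: (svalP (tagged (Q i))).1.
have pE i x : p i x = 0 <-> e i * x = 0 by exact: (svalP (tagged (Q i))).2.
have p_eq i x y : p i x = p i y <-> e i * x = e i * y.
  split=> [/eqP|/eqP]; rewrite -subr_eq0 -?rmorphB -?mulrBr => /eqP/pE/eqP.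
    by rewrite mulrBr subr_eq0 => /eqP.
  by rewrite rmorphB subr_eq0 => /eqP.
exists n, C, p; split=> [i|c].
  pose h : {rmorphism R -> C i} := p i \o g \o f.
  apply: (henselian_integral_local (f := h)) hensR _ _ _.
  - apply: (integral_surj (f := g \o f : {rmorphism R -> B}) (p := p i)) => //.
    by apply: integral_trans fI (finite_integral g_fin).
  - by rewrite -(rmorph1 (p i)) => /pE; rewrite mulr1; apply: e0.
  - move=> y; have [x <-] := p_surj i y; rewrite -rmorphM => /p_eq xx.
    have [x0|x0] := eqVneq (e i * x) 0; first by left; apply/pE.
    have [x1|x1] := eqVneq (e i * (1 - x)) 0.
      right; rewrite -(rmorph1 (p i)); apply/p_eq/eqP.
      by rewrite eq_sym -subr_eq0 -mulrBr x1.
    have [e' e'P] := idempotent_split eP xx (elimN eqP x0) (elimN eqP x1).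
    by have := n_max n.+1; rewrite ltnn => /(_ (asboolT (ex_intro _ e' e'P))).
have [b bE] := boolp.choice (fun i => p_surj i (c i)).
exists (\sum_i e i * b i); split=> [k|b' b'E].
  rewrite -bE; apply/p_eq; rewrite mulr_sumr (bigD1 k) //= mulrA ee big1 ?addr0 // => j jk.
  by rewrite mulrA eo ?mul0r // eq_sym.
rewrite -[b']mul1r -es mulr_suml; apply: eq_bigr => i _.
by apply/p_eq; rewrite b'E bE.
Qed.

(** * Algebraic extensions of separably closed fields *)

Lemma expn_sum_pchar (R : comNzRingType) (I : Type) (r : seq I) (F : I -> R) q :
  [pchar R].-nat q -> (\sum_(i <- r) F i) ^+ q = \sum_(i <- r) F i ^+ q.
Proof.
move=> q_pchar; apply: (big_morph (fun x => x ^+ q)) => [x y|]; first exact: exprDn_pchar.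
by rewrite expr0n; case: q q_pchar.
Qed.

(** Induction on the degree of [P]. A common factor of [P] and [P'] lowers the degree;
    if [P' = 0] then [P] is a polynomial in [X ^ p] and [alpha ^ p] has smaller degree;
    if [P] is separable it has a root in [k], and we divide it out. *)
Lemma sep_closed_radicial (k L : fieldType) (f : {rmorphism k -> L}) (P : {poly k}) alpha :
  separably_closed k -> P != 0 -> root (map_poly f P) alpha ->
  exists q c, [pchar k].-nat q /\ alpha ^+ q = f c.
Proof.
move=> k_closed; have [n] := ubnP (size P).
elim: n P alpha => // n IHn P alpha; rewrite ltnS => Pn P0 Pa.
have P_gt1 : (1 < size P)%N.
  rewrite ltnNge; apply/negP => /size1_polyC PE; move: Pa P0.
  rewrite PE map_polyC rootC /= => /eqP; rewrite -(rmorph0 f) => /fmorph_inj ->.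
  by rewrite eqxx.
have split_root (D E : {poly k}) : P = D * E -> (1 < size D)%N -> (1 < size E)%N ->
    exists q c, [pchar k].-nat q /\ alpha ^+ q = f c.
  move=> PE D1 E1; have [D0 E0] : D != 0 /\ E != 0.
    by apply/andP; rewrite -negb_or -mulf_eq0 -PE.
  have sP : size P = (size D + size E).-1 by rewrite PE size_mul.
  move: Pa; rewrite PE rmorphM rootM => /orP[/IHn|/IHn]; apply=> //;
    by apply: leq_trans Pn; rewrite sP; lia.
have [P'0|P'0] := eqVneq P^`() 0.
  have [m mP] : exists m, size P = m.+2 by case: (size P) P_gt1 => [|[|m]] // _; exists m.
  have dP i : (i.+1%:R == 0 :> k) || (P`_i.+1 == 0).
    by rewrite -mulf_eq0 mulr_natl -coef_deriv P'0 coef0.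
  have m0 : m.+1%:R == 0 :> k.
    case/orP: (dP m) => // /eqP Pm.
    by move: P0; rewrite -lead_coef_eq0 lead_coefE mP Pm eqxx.
  have [p p_char] := natf0_pchar (ltn0Sn m) m0.
  have p_pr := pcharf_prime p_char; have p_gt0 := prime_gt0 p_pr.
  pose G := \poly_(i < size P) P`_(i * p).
  have PG : P = G \Po 'X^p.
    apply/polyP => i; rewrite coef_comp_poly_Xn //; case: ifPn => [/dvdnP[j ->]|ip].
      rewrite mulnK // coef_poly; case: ltnP => // sj.
      by rewrite nth_default // (leq_trans sj) // leq_pmulr.
    case: i ip => [|i] ip; first by rewrite dvdn0 in ip.
    by apply/eqP; have := dP i; rewrite -(dvdn_pcharf p_char) (negPf ip).
  have G0 : G != 0 by apply: contra_neq P0 => G0; rewrite PG G0 comp_poly0.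
  have sG : (size G < n)%N.
    apply: leq_trans Pn; have := congr1 (fun u => (size (u : {poly k})).-1) PG.
    rewrite /= size_comp_poly size_polyXn mP /=; case: (size G) => // g /= mg.
    rewrite ltnS mg -[X in (X < _)%N]muln1 ltn_mul2l prime_gt1 // andbT.
    by rewrite lt0n; apply/eqP => g0; rewrite g0 in mg.
  have Ga : root (map_poly f G) (alpha ^+ p).
    by move: Pa; rewrite PG map_comp_poly /= map_polyXn /root horner_comp hornerXn.
  have [q [c [q_char qc]]] := IHn _ _ sG G0 Ga.
  by exists (p * q)%N, c; rewrite exprM pnatM q_char andbT (pnatE _ p_pr).
have [D1|D1] := eqVneq (size (gcdp P P^`())) 1.
  have Psep : separable_poly P by rewrite unlock /coprimep D1.
  have [c /factor_theorem[E PE]] := k_closed P Psep P_gt1.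
  have [E1|E1] := ltnP 1 (size E).
    by apply: split_root PE E1 _; rewrite size_XsubC.
  have E0 : E != 0 by apply: contra_neq P0 => E0; rewrite PE E0 mul0r.
  move: Pa; rewrite PE rmorphM rootM /= => /orP[].
    move: E0; rewrite (size1_polyC E1) map_polyC polyC_eq0 rootC /= => E0 /eqP.
    by rewrite -(rmorph0 f) => /fmorph_inj E00; rewrite E00 eqxx in E0.
  rewrite rmorphB /= map_polyX map_polyC root_XsubC => /eqP ->.
  by exists 1%N, c; rewrite expr1.
have D_dvd : gcdp P P^`() %| P by exact: dvdp_gcdl.
have D0 : gcdp P P^`() != 0 by rewrite gcdp_eq0 negb_and P0.
apply: (split_root (P %/ gcdp P P^`()) (gcdp P P^`())); first by rewrite divpK.
  rewrite size_divp // ltn_subRL addn1 prednK ?lt0n ?size_poly_eq0 //.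
  apply: leq_ltn_trans (leq_gcdpr _ P'0) _.
  exact: lt_size_deriv.
by rewrite ltn_neqAle eq_sym D1 lt0n size_poly_eq0.
Qed.

Lemma irreducible_factor (k : fieldType) (P : {poly k}) :
  P != 0 -> (1 < size P)%N -> exists2 D, irreducible_poly D & D %| P.
Proof.
move=> P0 P1; pose good n := `[< exists2 D : {poly k}, D %| P & (size D == n) && (1 < n)%N >].
have ex : exists n, good n by exists (size P); apply/asboolP; exists P; rewrite ?eqxx.
case: (ex_minnP ex) => n /asboolP[D DP /andP[/eqP sD n1]] n_min.
exists D => //; split=> [|q q1 qD]; first by rewrite sD.
rewrite -dvdp_size_eqp // eqn_leq dvdp_leq //= ?sD; last first.
  by rewrite -size_poly_eq0 sD -lt0n ltnW.
apply: n_min; apply/asboolP; exists q; first exact: dvdp_trans DP.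
rewrite eqxx ltn_neqAle eq_sym q1 lt0n size_poly_eq0 /=.
by apply: contra_neq P0 => q0; apply/eqP; rewrite -dvd0p -q0 (dvdp_trans qD).
Qed.

(** Adjoin a root [z] of an irreducible factor of a separable polynomial: [z] is
    separable over [K], but also purely inseparable, being algebraic over [k]. *)
Lemma sep_closed_algebraic (k K : fieldType) (f : {rmorphism k -> K}) :
  separably_closed k ->
  (forall beta, exists2 P : {poly k}, P != 0 & root (map_poly f P) beta) -> separably_closed K.
Proof.
move=> k_closed algK P Psep P1.
have P0 : P != 0 by exact: separable_poly_neq0.
have [D D_irr DP] := irreducible_factor P0 P1.
have Dsep : separable_poly D by exact: dvdp_separable Psep.
have [L _ [z Dz _]] := irredp_FAdjoin D_irr.
suff /vlineP[b zb] : z \in 1%VS.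
  exists b; have /dvdpP[q ->] := DP.
  by move: Dz; rewrite rootM zb -[_ *: _]/(in_alg L b) fmorph_root => ->; rewrite orbT.
rewrite -separable_inseparable_element; apply/andP; split.
  apply/separable_elementP; exists (map_poly (in_alg L) D).
  by rewrite alg_polyOver separable_map.
have rad i : exists qc : nat * k, [pchar k].-nat qc.1 /\ D`_i ^+ qc.1 = f qc.2.
  have [R R0 Ri] := algK D`_i; have [q [c qc]] := sep_closed_radicial k_closed R0 Ri.
  by exists (q, c).
have [qc qcE] := boolp.choice rad.
(* With a common exponent [Q] for all coefficients of [D], the element [z ^ Q] is a root
   of a polynomial [H] over [k]. *)
pose Q := (\prod_(i < size D) (qc i).1)%N.
have Q_char : [pchar k].-nat Q.
  rewrite /Q; elim/big_ind: _ => [//|m n|i _]; last exact: (qcE i).1.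
  by rewrite pnatM => -> ->.
have radQ (i : 'I_(size D)) : exists c, D`_i ^+ Q = f c.
  rewrite /Q (bigD1 i) //= exprM (qcE i).2 -rmorphXn.
  by eexists.
have [c cE] := boolp.choice radQ.
pose H := \poly_(i < size D) (if insub i is Some j then c j else 0).
have H0 : H != 0.
  have Dsize : ((size D).-1 < size D)%N by rewrite prednK // ltnW //; case: D_irr.
  apply/eqP => /polyP/(_ (size D).-1); rewrite coef0 coef_poly Dsize insubT /= => c0.
  have := cE (Ordinal Dsize); rewrite c0 rmorph0 /= => /eqP; rewrite expf_eq0 -lead_coefE.
  by rewrite lead_coef_eq0 (negPf (separable_poly_neq0 Dsep)) andbF.
pose g : {rmorphism k -> L} := in_alg L \o f.
have Q_charL : [pchar L].-nat Q by rewrite (eq_pnat _ (fmorph_pchar g)).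
have Hz : root (map_poly g H) (z ^+ Q).
  apply/eqP; rewrite (@horner_coef_wide _ (size D)) ?(leq_trans (size_poly _ _)) ?size_poly //.
  have Dz0 : \sum_(i < size D) in_alg L D`_i * z ^+ i = 0.
    rewrite -[RHS](eqP Dz) horner_coef size_map_poly.
    by apply: eq_bigr => i _; rewrite coef_map.
  transitivity ((\sum_(i < size D) in_alg L D`_i * z ^+ i) ^+ Q).
    rewrite expn_sum_pchar //; apply: eq_bigr => i _.
    by rewrite coef_map coef_poly ltn_ord valK exprMn exprAC -rmorphXn cE.
  by rewrite Dz0 expr0n; case/andP: Q_char; case: (Q).
have [q [d [q_char zq]]] := sep_closed_radicial k_closed H0 Hz.
apply/purely_inseparable_elementP_pchar; exists (Q * q)%N.
  by rewrite pnatM Q_charL (eq_pnat _ (fmorph_pchar g)).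
by rewrite exprM zq; apply/vlineP; exists (f d).
Qed.

(** Strict locality can thus be read off from locality and integrality alone. *)
Lemma strictly_local_integral (R S : comPzRingType) (f : {rmorphism R -> S}) :
  strictly_local R -> integral_map f -> local_ring S -> strictly_local S.
Proof.
case=> hensR [k [pi [pi_surj k_closed]]] fI locS.
split; first exact: henselian_integral fI locS.
have [K [rho rho_surj]] := local_point locS; exists K, rho; split=> //.
have [h hE] := residue_rmorphism hensR.1 pi_surj fI rho_surj.
apply: (sep_closed_algebraic (f := h)) => // beta; have [s <-] := rho_surj beta.
have /(@integral_eltP k K h)[P P_monic Ps] := integral_elt_rmorph hE (fI s).
by exists P; rewrite ?monic_neq0.
Qed.

(** * Flat and pure ring morphisms *)

Section TensorMaps.
Context (R : comPzRingType).
Implicit Types M N P : lmodType R.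

Lemma pure2Dl M N (x x' : M) (y : N) : pure2 (x + x') y = pure2 x y + pure2 x' y.
Proof. by have := (pure2_bilinear M N).1 y 1 x x'; rewrite !scale1r. Qed.
Lemma pure2Dr M N (x : M) (y y' : N) : pure2 x (y + y') = pure2 x y + pure2 x y'.
Proof. by have := (pure2_bilinear M N).2 x 1 y y'; rewrite !scale1r. Qed.
Lemma pure20 M N (x : M) : pure2 x (0 : N) = 0.
Proof. by apply: (addrI (pure2 x 0)); rewrite -pure2Dr !addr0. Qed.
Lemma pure02 M N (y : N) : pure2 (0 : M) y = 0.
Proof. by apply: (addrI (pure2 0 y)); rewrite -pure2Dl !addr0. Qed.
Lemma pure2Zl M N a (x : M) (y : N) : pure2 (a *: x) y = a *: pure2 x y.
Proof. by have := (pure2_bilinear M N).1 y a x 0; rewrite /= addr0 pure02 addr0. Qed.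
Lemma pure2Zr M N a (x : M) (y : N) : pure2 x (a *: y) = a *: pure2 x y.
Proof. by have := (pure2_bilinear M N).2 x a y 0; rewrite /= addr0 pure20 addr0. Qed.

Lemma tensor2_ind M N (Q : tensor2 M N -> Prop) :
  (forall x y, Q (pure2 x y)) -> (forall z z', Q z -> Q z' -> Q (z + z')) -> forall z, Q z.
Proof.
move=> Qpure QD z; rewrite [z]univ_comb; elim/big_ind: _ => [||[a [x y]] _] //.
  by rewrite -(pure20 N (0 : M)).
by rewrite -[univ_gen _ _]/(pure2 x y) -pure2Zl.
Qed.

Lemma tensor2_map_linear M N N' (u : {linear N -> N'}) :
  linear (tensor2_map (M := M) u).
Proof.
apply: univ_eval_linear; split=> [y|x] a z z' /=; first by rewrite pure2Dl pure2Zl.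
by rewrite linearP pure2Dr pure2Zr.
Qed.

Lemma tensor2_mapD M N N' (u : {linear N -> N'}) (z z' : tensor2 M N) :
  tensor2_map u (z + z') = tensor2_map u z + tensor2_map u z'.
Proof. by have := tensor2_map_linear u 1 z z'; rewrite !scale1r. Qed.

Lemma tensor2_map0 M N N' (u : {linear N -> N'}) : tensor2_map u (0 : tensor2 M N) = 0.
Proof. by apply: (addrI (tensor2_map u 0)); rewrite -tensor2_mapD !addr0. Qed.

Lemma tensor2_map_sum M N N' (u : {linear N -> N'}) (I : finType) (z : I -> tensor2 M N) :
  tensor2_map u (\sum_i z i) = \sum_i tensor2_map u (z i).
Proof. exact: (big_morph _ (tensor2_mapD u) (tensor2_map0 M u)). Qed.

Section Left.
Context (M M' N : lmodType R) (g : {linear M -> M'}).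

Fact tensor2_lmap_bilinear :
  @bilinear_map R M N (tensor2 M' N) (fun z => pure2 (g z.1) z.2).
Proof.
split=> [y|x] a z z' /=; first by rewrite linearP pure2Dl pure2Zl.
by rewrite pure2Dr pure2Zr.
Qed.

Definition tensor2_lmap : {linear tensor2 M N -> tensor2 M' N} :=
  univ_lift tensor2_lmap_bilinear.

Lemma tensor2_lmap_pure x y : tensor2_lmap (pure2 x y) = pure2 (g x) y.
Proof. exact: (univ_eval_gen _ tensor2_lmap_bilinear). Qed.

End Left.

Lemma tensor2_lmap_map M M' N N' (g : {linear M -> M'}) (u : {linear N -> N'}) z :
  tensor2_lmap N' g (tensor2_map u z) = tensor2_map u (tensor2_lmap N g z).
Proof.
elim/tensor2_ind: z => [x y|z z' hz hz'].
  by rewrite tensor2_map_pure !tensor2_lmap_pure tensor2_map_pure.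
by rewrite tensor2_mapD !linearD tensor2_mapD hz hz'.
Qed.

Lemma tensor2_lmap_comp M M' M'' N (g : {linear M -> M'}) (g' : {linear M' -> M''})
    (g'' : {linear M -> M''}) z : (forall x, g' (g x) = g'' x) ->
  tensor2_lmap N g' (tensor2_lmap N g z) = tensor2_lmap N g'' z.
Proof.
move=> gg; elim/tensor2_ind: z => [x y|z z' hz hz']; first by rewrite !tensor2_lmap_pure gg.
by rewrite !linearD hz hz'.
Qed.

Lemma tensor2_map_comp0 M N P P' (u : {linear N -> P}) (v : {linear P -> P'}) z :
  (forall x, v (u x) = 0) -> tensor2_map v (tensor2_map u (z : tensor2 M N)) = 0.
Proof.
move=> vu; elim/tensor2_ind: z => [x y|z z' hz hz'].
  by rewrite !tensor2_map_pure vu pure20.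
by rewrite !tensor2_mapD hz hz' addr0.
Qed.

End TensorMaps.

Lemma restr_linear (R S S' : comPzRingType) (f : {rmorphism R -> S})
    (f' : {rmorphism R -> S'}) (g : S -> S') :
  (forall x y, g (x + y) = g x + g y) -> (forall a x, g (f a * x) = f' a * g x) ->
  {h : {linear restr f -> restr f'} | h =1 g}.
Proof.
move=> gD gZ; have gl : linear (g : restr f -> restr f').
  by move=> a x y; rewrite [LHS]gD; congr (_ + _); exact: gZ.
pose h : {linear restr f -> restr f'} :=
  HB.pack (g : restr f -> restr f') (GRing.isLinear.Build R (restr f) (restr f') _ g gl).
by exists h.
Qed.

Lemma rmorph_restr_linear (R S S' : comPzRingType) (f : {rmorphism R -> S})
    (f' : {rmorphism R -> S'}) (g : {rmorphism S -> S'}) :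
  (forall x, g (f x) = f' x) -> {h : {linear restr f -> restr f'} | h =1 g}.
Proof. by move=> gf; apply: restr_linear => [x y|a x]; rewrite ?rmorphD ?rmorphM ?gf. Qed.

Section FlatPure.
Context (R : comPzRingType).

Definition flat (S : comPzRingType) (f : {rmorphism R -> S}) : Prop :=
  forall (M N P : lmodType R) (u : {linear M -> N}) (v : {linear N -> P}),
    exact_at u v -> exact_at (tensor2_map (M := restr f) u) (tensor2_map (M := restr f) v).

(** [N / u M] embeds into [S (x) (N / u M)], said without forming the quotient. *)
Definition pure_map (S : comPzRingType) (f : {rmorphism R -> S}) : Prop :=
  forall (M N : lmodType R) (u : {linear M -> N}) (n : N),
    (exists z, tensor2_map (M := restr f) u z = pure2 (1 : restr f) n) ->
    exists m, u m = n.

(** Purity for [u] recovers [ker v <= im u]; purity for [0 : P -> P] shows that [p |-> 1 (x) p]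
    is injective, which recovers [v u = 0]. *)
Lemma flat_pure_faithful (S : comPzRingType) (f : {rmorphism R -> S}) :
  flat f -> pure_map f -> faithfully_flat f.
Proof.
move=> fl pu M N P u v; split; first exact: fl.
have pure0 (p : P) : pure2 (1 : restr f) p = 0 -> p = 0.
  move=> p0; pose z : {linear P -> P} := \0%R.
  have [|m <- //] := pu P P z p.
  by exists 0; rewrite tensor2_map0 p0.
move=> ex y; split=> [vy|[x <-]].
  apply: pu; have [h _] := ex (pure2 (1 : restr f) y); apply: h.
  by rewrite tensor2_map_pure vy pure20.
apply: pure0; rewrite -!(tensor2_map_pure _ (1 : restr f)).
by apply/(ex _).2; exists (pure2 (1 : restr f) x).
Qed.

Lemma flat_pure_id (f : {rmorphism R -> R}) : (forall x, f x = x) -> flat f /\ pure_map f.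
Proof.
move=> f_id.
have pure1 N (z : tensor2 (restr f) N) : exists n, z = pure2 (1 : restr f) n.
  elim/tensor2_ind: z => [x y|_ _ [n ->] [n' ->]]; last by exists (n + n'); rewrite pure2Dr.
  exists ((x : R) *: y); rewrite pure2Zr -pure2Zl; congr pure2.
  by rewrite [RHS]restr_scaleE f_id mulr1.
have pure1_inj (N : lmodType R) (n : N) : pure2 (1 : restr f) n = 0 -> n = 0.
  have [|h [hE _]] := @tensor2_univ R (restr f) N N (fun z => (z.1 : R) *: z.2).
    split=> [y|x] a z z' /=.
      by rewrite scalerDl -[a *: z]/(f a * (z : R)) f_id scalerA.
    by rewrite scalerDr !scalerA mulrC.
  by move=> n0; rewrite -[n]scale1r -(hE 1 n) n0 linear0.
split=> [M N P u v ex y|M N u n [z]].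
  have [n ->] := pure1 _ y; split.
    rewrite tensor2_map_pure => /pure1_inj/ex[x <-].
    by exists (pure2 (1 : restr f) x); rewrite tensor2_map_pure.
  case=> x <-; apply: tensor2_map_comp0 => x'.
  by apply/(ex _).2; exists x'.
have [m ->] := pure1 _ z; rewrite tensor2_map_pure => um; exists m.
by apply/subr0_eq/pure1_inj; rewrite pure2Dr um -scaleN1r pure2Zr scaleN1r subrr.
Qed.

Section Retract.
Context (S A : comPzRingType) (f : {rmorphism R -> S}) (h : {rmorphism R -> A}).

(** The hypothesis makes [A] a direct summand, as an [R]-module, of a finite power of [S];
    an element of [A (x) N] is tested on its components in [S (x) N]. *)
Lemma flat_retract (J : finType) (a : J -> {linear restr h -> restr f})
    (b : J -> {linear restr f -> restr h}) :
  (forall s, \sum_j b j (a j s) = s) -> flat f -> flat h.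
Proof.
move=> ba fl M N P u v ex y; split=> [vy|[x <-]]; last first.
  by apply: tensor2_map_comp0 => x'; apply/(ex _).2; exists x'.
have /boolp.choice[x xE] j : exists x, tensor2_map u x = tensor2_lmap N (a j) y.
  by apply/(fl _ _ _ _ _ ex); rewrite -tensor2_lmap_map vy linear0.
exists (\sum_j tensor2_lmap M (b j) (x j)); rewrite tensor2_map_sum.
under eq_bigr do rewrite -tensor2_lmap_map xE.
elim/tensor2_ind: y {vy x xE} => [s n|z z' hz hz'].
  under eq_bigr do rewrite !tensor2_lmap_pure.
  rewrite -[X in _ = pure2 X _]ba.
  by rewrite (big_morph (fun s => pure2 s n) (fun s s' => pure2Dl s s' n) (pure02 _ n)).
under eq_bigr do rewrite !linearD.
by rewrite big_split /= hz hz'.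
Qed.

Lemma pure_retract (a : {linear restr h -> restr f}) :
  a 1 = 1 -> pure_map f -> pure_map h.
Proof.
move=> a1 pu M N u n [z zE]; apply: pu; exists (tensor2_lmap M a z).
by rewrite -tensor2_lmap_map zE tensor2_lmap_pure a1.
Qed.

End Retract.

Section Colimit.
Context (J : Type) (le : rel J) (leJ : directed le) (F : J -> comPzRingType).
Context (t : forall i j, le i j -> {rmorphism F i -> F j}).
Hypothesis t_comp : forall i j k (ij : le i j) (jk : le j k) (ik : le i k) x,
  t jk (t ij x) = t ik x.
Context (S : comPzRingType) (c : forall j, {rmorphism F j -> S}).
Hypothesis ct : forall i j (ij : le i j) x, c j (t ij x) = c i x.
Hypothesis c_surj : forall s, exists j x, c j x = s.
Hypothesis c_eq0 : forall j x, c j x = 0 ->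
  eventually le (fun k => forall jk : le j k, t jk x = 0).
Context (g : forall j, {rmorphism R -> F j}) (f : {rmorphism R -> S}).
Hypothesis tg : forall i j (ij : le i j) x, t ij (g i x) = g j x.
Hypothesis cg : forall j x, c j (g j x) = f x.

Let cl j : {linear restr (g j) -> restr f} := sval (rmorph_restr_linear (cg j)).
Let clE j : cl j =1 c j. Proof. exact: svalP (rmorph_restr_linear (cg j)). Qed.
Let tl i j (ij : le i j) : {linear restr (g i) -> restr (g j)} :=
  sval (rmorph_restr_linear (tg ij)).
Let tlE i j (ij : le i j) : tl ij =1 t ij.
Proof. exact: svalP (rmorph_restr_linear (tg ij)). Qed.

Let cltl N i j (ij : le i j) z :
  tensor2_lmap N (cl j) (tensor2_lmap N (tl ij) z) = tensor2_lmap N (cl i) z.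
Proof. by apply: tensor2_lmap_comp => x; rewrite tlE !clE ct. Qed.

Lemma colimit_tensor_surj N (z : tensor2 (restr f) N) :
  exists j z', z = tensor2_lmap N (cl j) z'.
Proof.
elim/tensor2_ind: z => [s n|_ _ [i [z ->]] [j [z' ->]]].
  have [j [x <-]] := c_surj s; exists j, (pure2 (x : restr (g j)) n).
  by rewrite tensor2_lmap_pure clE.
have [_ _ _ /(_ i j)[k ik jk]] := leJ.
by exists k, (tensor2_lmap N (tl ik) z + tensor2_lmap N (tl jk) z'); rewrite linearD !cltl.
Qed.

(** Tensor products commute with filtered colimits: sending [s (x) p] to the germ of
    [s_k (x) p], where [s_k] lifts [s] to [F k] for large [k], is well defined. *)
Lemma colimit_tensor_eq0 P j (z : tensor2 (restr (g j)) P) :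
  tensor2_lmap P (cl j) z = 0 -> exists k (jk : le j k), tensor2_lmap P (tl jk) z = 0.
Proof.
have [G [p pE]] := germ_module leJ (fun k => tensor2 (restr (g k)) P : lmodType R).
have p_eq (y y' : mod_family (fun k => tensor2 (restr (g k)) P : lmodType R)) :
    eventually le (fun k => y k = y' k) -> p y = p y'.
  move=> ev; apply/eqP; rewrite -subr_eq0 -linearB; apply/eqP/pE.
  by apply: eventually_mono ev => k yy; rewrite -[LHS]/(y k - y' k) yy subrr.
have /boolp.choice[l lE] : forall s, exists jx : {j & F j}, c (tag jx) (tagged jx) = s.
  by move=> s; have [i [x xs]] := c_surj s; exists (Tagged F x).
pose lift s k : restr (g k) :=
  if @idP (le (tag (l s)) k) is ReflectT ik then t ik (tagged (l s)) else 0.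
have liftE i x : eventually le (fun k => forall ik : le i k, lift (c i x) k = t ik x).
  set s := c i x; have [_ _ tr dir] := leJ.
  have [m lm im] := dir (tag (l s)) i.
  have [|k0 k0E] := @c_eq0 m (t lm (tagged (l s)) - t im x).
    by rewrite rmorphB !ct lE subrr.
  have [k1 mk1 k01] := dir m k0; exists k1 => k k1k ik.
  have mk := tr _ _ _ mk1 k1k; have lk := tr _ _ _ lm mk.
  rewrite /lift; case: {-}_ / idP => // lk'; rewrite (bool_irrelevance lk' lk).
  have /(_ mk) := k0E k (tr _ _ _ k01 k1k).
  by rewrite rmorphB !(t_comp _ _ lk, t_comp _ _ ik) => /subr0_eq.
(* The chosen lifts are additive only at large stages, which is enough for germs. *)
have bil : @bilinear_map R (restr f) P G (fun z => p (fun k => pure2 (lift z.1 k) z.2)).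
  split=> [y|s] a x x' /=; rewrite -linearP; apply: p_eq; last first.
    apply: eventually_all => // k.
    by rewrite -[RHS]/(a *: pure2 _ _ + pure2 _ _) pure2Dr pure2Zr.
  have [i [w [w' [wE w'E]]]] : exists i w w', c i w = x /\ c i w' = x'.
    have [i [w wE]] := c_surj x; have [i' [w' w'E]] := c_surj x'.
    have [_ _ _ /(_ i i')[m im i'm]] := leJ.
    by exists m, (t im w), (t i'm w'); rewrite !ct.
  have e1 := liftE i w; have e2 := liftE i w'; have e3 := liftE i (g i a * w + w').
  apply: eventually_mono (eventually_and leJ (eventually_ge le i)
    (eventually_and leJ e1 (eventually_and leJ e2 e3))) => k.
  move=> [ik [/(_ ik) h1 [/(_ ik) h2 /(_ ik) h3]]].
  rewrite -[RHS]/(a *: pure2 _ _ + pure2 _ _) -pure2Zl -pure2Dl; congr pure2.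
  rewrite -wE -w'E h1 h2; move: h3; rewrite rmorphD rmorphM cg => ->.
  by rewrite rmorphD rmorphM tg.
have [h [hE _]] := tensor2_univ bil.
pose germ (y : tensor2 (restr (g j)) P) k : tensor2 (restr (g k)) P :=
  if @idP (le j k) is ReflectT jk then tensor2_lmap P (tl jk) y else 0.
have germE y k (jk : le j k) : germ y k = tensor2_lmap P (tl jk) y.
  by rewrite /germ; case: {-}_ / idP => // jk'; rewrite (bool_irrelevance jk' jk).
have hz : h (tensor2_lmap P (cl j) z) = p (germ z).
  elim/tensor2_ind: z => [x y|z z' hz hz'].
    rewrite tensor2_lmap_pure hE clE; apply: p_eq.
    have ev := eventually_and leJ (eventually_ge le j) (liftE j x).
    apply: eventually_mono ev => k [jk /(_ jk) e].
    by rewrite germE tensor2_lmap_pure tlE /= e.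
  rewrite !linearD hz hz' -linearD; apply: p_eq; exists j => k jk.
  by rewrite -[LHS]/(germ z k + germ z' k) !germE linearD.
move=> z0; have /pE ev : p (germ z) = 0 by rewrite -hz z0 linear0.
have [k jk] := eventually_ex leJ j ev.
by rewrite germE => zk; exists k, jk.
Qed.

(** An element killed by [v] comes from a stage, and is killed at a later one, where
    flatness applies. *)
Lemma flat_colimit : (forall j, flat (g j)) -> flat f.
Proof.
move=> fl M N P u v ex y; split=> [vy|[x <-]]; last first.
  by apply: tensor2_map_comp0 => x'; apply/(ex _).2; exists x'.
have [j [y' yE]] := colimit_tensor_surj y.
move: vy; rewrite yE -tensor2_lmap_map => /colimit_tensor_eq0[k [jk]].
rewrite tensor2_lmap_map => /(fl k _ _ _ _ _ ex)[x xE].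
by exists (tensor2_lmap M (cl k) x); rewrite -tensor2_lmap_map xE cltl.
Qed.

Lemma pure_colimit : (forall j, pure_map (g j)) -> pure_map f.
Proof.
move=> pu M N u n [z zE]; have [j [z' z'E]] := colimit_tensor_surj z.
have [|k [jk]] := @colimit_tensor_eq0 N j (tensor2_map u z' - pure2 (1 : restr (g j)) n).
  by rewrite linearB tensor2_lmap_map -z'E zE tensor2_lmap_pure clE rmorph1 subrr.
rewrite linearB tensor2_lmap_map tensor2_lmap_pure tlE rmorph1 => /subr0_eq uz.
by apply: (pu k); exists (tensor2_lmap M (tl jk) z').
Qed.

End Colimit.

End FlatPure.

(** * Finite flat algebras over a local ring *)

Section ConnectedSpectrum.
Context (A : comPzRingType).

Lemma prime_containing (x : A) : ~ invertible x -> exists p : spec A, spec_set p x.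
Proof.
move=> /not_invertible_point[K [rho [rho_surj rx]]].
suff pp : prime_ideal (fun y => rho y = 0) by exists (Spec pp).
have [idk k1 _] := kernel_maximal rho_surj.
split=> // y z /eqP; rewrite rmorphM mulf_eq0 => /orP[] /eqP; [left|right] => //.
Qed.

Lemma idempotent_invertible (e : A) : e * e = e -> invertible e -> e = 1.
Proof. by move=> ee [u eu]; rewrite -[LHS]mulr1 -eu mulrA ee. Qed.

(** [V(e)] is open and closed for an idempotent [e], its complement being [V(1 - e)]. *)
Lemma connected_idempotent (e : A) :
  connected [set: spec A]%classic -> e * e = e -> e = 0 \/ e = 1.
Proof.
move=> conA ee; apply: contrapT => /not_orP[e0 e1].
have ne : ~ invertible e by move/(idempotent_invertible ee).
have ee' : (1 - e) * (1 - e) = 1 - e by rewrite mulrBl mul1r mulrBr mulr1 ee subrr subr0.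
have ne' : ~ invertible (1 - e).
  move/(idempotent_invertible ee') => h; apply: e0.
  by apply: (addrI (1 - e)); rewrite addr0 subrK.
have both (p : spec A) : spec_set p e -> spec_set p (1 - e) -> False.
  have [[p0 pD] p1 _] := spec_prime p; move=> pe pe'; apply: p1.
  by rewrite -[1](subrK e) -[1 - e]mul1r; apply: pD.
have one (p : spec A) : spec_set p e \/ spec_set p (1 - e).
  have [[p0 pD] p1 pM] := spec_prime p; apply: pM.
  by rewrite mulrBr mulr1 ee subrr.
have [p pe] := prime_containing ne; have [q qe] := prime_containing ne'.
have : [set p : spec A | spec_set p e]%classic = setT.
  apply: conA; first by exists p.
    exists [set p : spec A | spec_set p e]%classic; last by rewrite setTI.
    exists [set 1 - e]%classic; rewrite eqEsubset; split=> r /=.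
      by move=> re h; apply: (both r re); apply: h.
    by move=> h; have [//|re] := one r; case: h => x ->.
  exists [set p : spec A | spec_set p e]%classic; last by rewrite setTI.
  rewrite -openC; exists [set e]%classic; congr (~` _)%classic.
  by rewrite eqEsubset; split=> r /= h; [move=> x -> | apply: h].
by rewrite -subTset => /(_ q I) /= /both; apply.
Qed.

End ConnectedSpectrum.

(** Tensor with the inclusion into [R^n] of the module of relations among the [r i]. *)
Lemma flat_relation (R S : comPzRingType) (f : {rmorphism R -> S}) n (r : 'I_n -> R)
    (s : 'I_n -> S) :
  flat f -> \sum_i f (r i) * s i = 0 ->
  exists m (a : 'I_n -> 'I_m -> R) (y : 'I_m -> S),
    (forall i, s i = \sum_j f (a i j) * y j) /\ forall j, \sum_i r i * a i j = 0.
Proof.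
move=> fl rs.
have v_lin : linear (fun x : 'rV[R]_n => \sum_i r i * x 0 i : R^o).
  move=> a x y; rewrite scaler_sumr -big_split /=; apply: eq_bigr => i _.
  by rewrite !mxE mulrDr mulrCA.
pose v : {linear 'rV[R]_n -> R^o} := HB.pack (fun x : 'rV[R]_n => \sum_i r i * x 0 i : R^o)
  (GRing.isLinear.Build _ _ _ _ _ v_lin).
have subK : submodule (fun x : 'rV[R]_n => v x = 0).
  by split=> [|a x y vx vy]; rewrite ?linear0 // linearP vx vy scaler0 addr0.
have [M [u [u_inj uE]]] := submodule_exists subK.
have ex : exact_at u v by move=> x; exact: uE.
pose z : tensor2 (restr f) 'rV[R]_n := \sum_i pure2 (s i : restr f) (delta_mx 0 i).
have vz : tensor2_map v z = 0.
  rewrite tensor2_map_sum -[RHS](pure02 _ (1 : R^o)) -[in RHS]rs.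
  rewrite [RHS](big_morph _ (fun s s' : restr f => pure2Dl s s' (1 : R^o)) (pure02 _ _)) /=.
  apply: eq_bigr => i _; rewrite tensor2_map_pure /=.
  have -> : \sum_j r j * (delta_mx 0 i : 'rV[R]_n) 0 j = r i *: (1 : R^o).
    rewrite (bigD1 i) //= mxE !eqxx mulr1 big1 ?addr0 ?[RHS]mulr1 // => j ji.
    by rewrite mxE (negPf ji) andbF mulr0.
  by rewrite pure2Zr -pure2Zl.
have [x xz] := (fl _ _ _ _ _ ex z).1 vz.
have [m [y [k xE]]] : exists m (y : 'I_m -> restr f) (k : 'I_m -> M),
    x = \sum_j pure2 (y j) (k j).
  rewrite [x]univ_comb; set l := repr x.
  exists (size l), (fun j => (tnth (in_tuple l) j).1 *: (tnth (in_tuple l) j).2.1).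
  exists (fun j => (tnth (in_tuple l) j).2.2); rewrite big_tnth.
  by apply: eq_bigr => j _; case: (tnth _ j) => a [w k] /=; rewrite pure2Zl.
exists m, (fun i j => u (k j) 0 i), y; split=> [i|j]; last first.
  by have /uE : exists w, u w = u (k j) by exists (k j).
have [|chi [chiE _]] := @tensor2_univ R (restr f) 'rV[R]_n (restr f) (fun w => w.2 0 i *: w.1).
  split=> [w|w] a w1 w2 /=; first by rewrite scalerDr !scalerA mulrC.
  by rewrite !mxE scalerDl scalerA.
have := congr1 chi xz; rewrite xE tensor2_map_sum !linear_sum /=.
under eq_bigr do rewrite tensor2_map_pure chiE /=.
under [in X in _ = X -> _]eq_bigr do rewrite chiE /=.
move=> e; rewrite [RHS]e (bigD1 i) //= mxE !eqxx scale1r big1 ?addr0 // => j ji.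
by rewrite mxE eq_sym (negPf ji) scale0r.
Qed.

Section FiniteFree.
Context (R A : comPzRingType) (f : {rmorphism R -> A}).

Definition generates n (g : 'I_n -> A) : Prop :=
  forall s, exists c : 'I_n -> R, s = \sum_(i < n) f (c i) * g i.

Definition functional (l : A -> R) : Prop :=
  (forall x y, l (x + y) = l x + l y) /\ forall a x, l (f a * x) = a * l x.

(** [A] is a finite projective [R]-module, with generators [e] and dual functionals [l]. *)
Definition dual_basis (I : finType) (e : I -> A) (l : I -> A -> R) : Prop :=
  (forall i, functional (l i)) /\ forall s, s = \sum_i f (l i s) * e i.

(** The second half says that [R] is a direct summand of the [R]-module [A]. *)
Definition finite_split : Prop :=
  (exists n (e : 'I_n -> A) (l : 'I_n -> A -> R), dual_basis e l) /\
  exists2 l, functional l & exists x, l x = 1.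

Lemma generates_drop n (g : 'I_n.+1 -> A) (d : 'I_n.+1 -> R) i :
  generates g -> \sum_j f (d j) * g j = 0 -> invertible (d i) ->
  exists g' : 'I_n -> A, generates g'.
Proof.
move=> gen dg [u du]; exists (fun k => g (lift i k)) => s.
have gi : g i = - \sum_k f (u * d (lift i k)) * g (lift i k).
  move/(congr1 ( *%R (f u))): dg; rewrite mulr0 (bigD1_ord i) //= mulrDr mulrA -rmorphM.
  rewrite mulrC mulrC [u * _]mulrC du rmorph1 mul1r mulr_sumr => /eqP.
  rewrite addr_eq0 => /eqP ->; congr (- _); apply: eq_bigr => k _.
  by rewrite mulrA rmorphM.
have [c ->] := gen s; exists (fun k => c (lift i k) - c i * (u * d (lift i k))).
rewrite (bigD1_ord i) //= gi mulrN mulr_sumr addrC -sumrB; apply: eq_bigr => k _.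
by rewrite rmorphB mulrBl !rmorphM !mulrA.
Qed.

(** A minimal system of generators [g] is free: if [r . g = 0], flatness gives
    [g = a y] with [r a = 0], and [y = b g]; by minimality [a b] is the identity modulo the
    maximal ideal, hence invertible, and [r (a b) = 0]. *)
Lemma local_finite_flat_free : local_ring R -> finite_map f -> flat f ->
  exists n (g : 'I_n -> A), generates g /\
    forall r : 'I_n -> R, \sum_i f (r i) * g i = 0 -> forall i, r i = 0.
Proof.
move=> locR f_fin fl.
have ex : exists n, `[< exists g : 'I_n -> A, generates g >].
  by have [n [g gen]] := f_fin; exists n; apply/asboolP; exists g.
case: (ex_minnP ex) => n /asboolP[g gen] n_min; exists n, g; split=> // r rg.
have [m [a [y [gy ra]]]] := flat_relation fl rg.
have [b bE] := boolp.choice (fun j => gen (y j)).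
have R1 : (1 : R) != 0 by apply/eqP/local_neq0.
pose R' := nontrivial R1.
pose a' : 'M[R']_(n, m) := \matrix_(i, j) a i j.
pose b' : 'M[R']_(m, n) := \matrix_(i, j) b i j.
pose c := a' *m b'; pose r' : 'rV[R']_n := \row_i r i.
have rc : r' *m c = 0.
  rewrite mulmxA; have -> : r' *m a' = 0; last by rewrite mul0mx.
  apply/rowP => j; rewrite !mxE -[RHS](ra j); apply: eq_bigr => i _; by rewrite !mxE.
have gc i : \sum_l f (c i l) * g l = g i.
  rewrite gy; under eq_bigr do rewrite mxE rmorph_sum mulr_suml.
  rewrite exchange_big; apply: eq_bigr => j _; rewrite [in RHS]bE mulr_sumr.
  by apply: eq_bigr => l _; rewrite !mxE rmorphM mulrA.
have c1 i l : ~ invertible ((i == l)%:R - c i l : R).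
  (* An invertible coefficient in [g i - (c g) i = 0] makes the generator [g l] superfluous. *)
  case: n => [|n] in g gen n_min i l r rg a gy ra b bE a' b' c r' rc gc *; first by case: i.
  move=> inv; have [|g' gen'] := generates_drop (d := fun l => (i == l)%:R - c i l) gen _ inv.
    under eq_bigr do rewrite rmorphB mulrBl.
    rewrite sumrB gc (bigD1 i) //= eqxx rmorph1 mul1r big1 ?addr0 ?subrr // => j.
    by rewrite eq_sym => /negPf ->; rewrite rmorph0 mul0r.
  by have := n_min n (asboolT (ex_intro _ g' gen')); rewrite ltnn.
have [K [rho rho_surj]] := local_point locR.
pose rho' : {rmorphism R' -> K} := rho.
have [u cu] : invertible (\det c : R).
  apply: contrapT => /(local_kernel locR _ rho_surj).
  rewrite -[rho _]/(rho' (\det c)) -det_map_mx.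
  have -> : map_mx rho' c = 1%:M.
    apply/matrixP => i l; rewrite !mxE; apply/eqP; rewrite eq_sym -subr_eq0.
    have /(local_kernel locR _ rho_surj) := c1 i l.
    by rewrite rmorphB rmorph_nat !mxE => ->.
  by rewrite det1 => /eqP; rewrite oner_eq0.
have detr : \det c *: r' = 0.
  by rewrite -mul_mx_scalar -mul_mx_adj mulmxA rc mul0mx.
move=> i; have /rowP/(_ i) := detr; rewrite !mxE => dr.
by rewrite -[LHS]mul1r -cu mulrAC [_ * r i]dr mul0r.
Qed.

Lemma local_finite_flat_split : local_ring R -> finite_map f -> flat f -> (1 : A) <> 0 ->
  finite_split.
Proof.
move=> locR f_fin fl A1; have [n [g [gen indep]]] := local_finite_flat_free locR f_fin fl.
have [l lE] := boolp.choice gen.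
have l_unique (s : A) (c : 'I_n -> R) i : s = \sum_i f (c i) * g i -> l s i = c i.
  move=> sc; apply/subr0_eq; apply: (indep (fun i => l s i - c i)).
  by under eq_bigr do rewrite rmorphB mulrBl; rewrite sumrB -lE -sc subrr.
have lfun i : functional (fun s => l s i).
  split=> [x y|a x].
    apply: (l_unique _ (fun i => l x i + l y i)).
    under eq_bigr do rewrite rmorphD mulrDl.
    by rewrite big_split /= -!lE.
  apply: (l_unique _ (fun i => a * l x i)).
  under eq_bigr do rewrite rmorphM -mulrA.
  by rewrite -mulr_sumr -lE.
split; first by exists n, g, (fun i s => l s i); split.
case: n => [|n] in g gen indep l lE l_unique lfun *.
  by have := lE 1; rewrite big_ord0.
exists (fun s => l s ord0) => //; exists (g ord0).
rewrite (l_unique _ (fun i => (i == ord0)%:R)) ?eqxx //.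
rewrite big_ord_recl /= rmorph1 mul1r big1 ?addr0 // => i _.
by rewrite rmorph0 mul0r.
Qed.

Lemma finite_split_finite : finite_split -> finite_map f.
Proof.
by case=> -[n [e [l [_ eE]]]] _; exists n, e => s; exists (fun i => l i s).
Qed.

Lemma finite_split_neq0 : (1 : R) <> 0 -> finite_split -> (1 : A) <> 0.
Proof.
move=> R1 [_ [l [lD lM] [x lx]]] A1; apply: R1.
rewrite -lx (zero_ring x A1); apply: (addrI (l 0)).
by rewrite -lD !addr0.
Qed.

Lemma dual_basis_widen n N (e : 'I_n -> A) (l : 'I_n -> A -> R) :
  (n <= N)%N -> dual_basis e l ->
  exists (e' : 'I_N -> A) (l' : 'I_N -> A -> R), dual_basis e' l'.
Proof.
move=> nN [lfun lE].
exists (fun i => if insub (val i) is Some k then e k else 0).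
exists (fun i => if insub (val i) is Some k then l k else fun=> 0).
split=> [i|s].
  by case: insubP => // _; split=> *; rewrite ?addr0 ?mulr0.
pose F i := f ((if insub i is Some k then l k else fun=> 0) s) *
  (if insub i is Some k then e k else 0).
transitivity (\sum_(i < n) F i).
  by rewrite [LHS]lE; apply: eq_bigr => i _; rewrite /F valK.
rewrite (big_ord_widen_cond N xpredT F) // big_mkcond /=; apply: eq_bigr => i _.
case: ltnP => // ni.
have -> : insub (val i) = None :> option 'I_n by apply: insubF; rewrite ltnNge ni.
by rewrite mulr0.
Qed.

End FiniteFree.

(** Over the zero ring every sequence becomes exact. *)
Lemma faithfully_flat_neq0 (R A : comPzRingType) (f : {rmorphism R -> A}) :
  (1 : R) <> 0 -> faithfully_flat f -> (1 : A) <> 0.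
Proof.
move=> R1 ff A1; apply: R1.
have t0 (N : lmodType R) (z : tensor2 (restr f) N) : z = 0.
  elim/tensor2_ind: z => [x y|_ _ -> ->]; last by rewrite addr0.
  by rewrite (zero_ring (x : A) A1) [pure2 _ _]pure02.
pose v : {linear R^o -> R^o} := idfun.
have ex : exact_at v v.
  by apply/(ff _ _ _ v v) => y; split=> _; [exists 0; rewrite (t0 _ y)|]; apply: t0.
by apply/(ex (1 : R^o)).2; exists 1.
Qed.

(** * Algebras with radicial closed fibre *)

Section Radicial.
Context (R B : comPzRingType) (f : {rmorphism R -> B}) (k : fieldType).

(** Some power [b ^ q], with [q] a power of the residue characteristic exponent,
    agrees with an element of [R] at all closed points of [B] at once. *)
Definition radicial_elt (b : B) : Prop :=
  exists q r, [pchar k].-nat q /\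
    forall (K : fieldType) (rho : {rmorphism B -> K}), surjective rho -> rho b ^+ q = rho (f r).

Context (pi : {rmorphism R -> k}) (pi_surj : surjective pi).
Hypotheses (locR : local_ring R) (f_int : integral_map f).

Lemma point_pchar (K : fieldType) (rho : {rmorphism B -> K}) q :
  surjective rho -> [pchar k].-nat q -> [pchar K].-nat q.
Proof.
move=> /(residue_rmorphism locR pi_surj f_int)[h _].
by rewrite (eq_pnat _ (fmorph_pchar h)).
Qed.

Lemma radicial_scalar a : radicial_elt (f a).
Proof. by exists 1%N, a; split=> // K rho _; rewrite expr1. Qed.

Lemma radicialD b b' : radicial_elt b -> radicial_elt b' -> radicial_elt (b + b').
Proof.
move=> [q [r [q_char bq]]] [q' [r' [q'_char bq']]].
have qq' : [pchar k].-nat (q * q')%N by rewrite pnatM q_char.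
exists (q * q')%N, (r ^+ q' + r' ^+ q); split=> // K rho rho_surj.
rewrite [in LHS]rmorphD exprDn_pchar ?(point_pchar rho_surj) //.
by rewrite [in LHS]exprM mulnC [in LHS]exprM bq // bq' // !rmorphD !rmorphXn.
Qed.

Lemma radicialM b b' : radicial_elt b -> radicial_elt b' -> radicial_elt (b * b').
Proof.
move=> [q [r [q_char bq]]] [q' [r' [q'_char bq']]].
have qq' : [pchar k].-nat (q * q')%N by rewrite pnatM q_char.
exists (q * q')%N, (r ^+ q' * r' ^+ q); split=> // K rho rho_surj.
rewrite [in LHS]rmorphM exprMn.
by rewrite [in LHS]exprM mulnC [in LHS]exprM bq // bq' // !rmorphM !rmorphXn.
Qed.

Lemma radicial_prod (I : Type) (s : seq I) (F : I -> B) :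
  (forall i, radicial_elt (F i)) -> radicial_elt (\prod_(i <- s) F i).
Proof.
move=> FI; elim/big_ind: _ => //; first by rewrite -(rmorph1 f); apply: radicial_scalar.
exact: radicialM.
Qed.

(** All closed points of [B] vanish at the same elements: [b] vanishes there iff
    [r] lies in the maximal ideal of [R]. *)
Lemma radicial_local : (1 : B) <> 0 -> (forall b, radicial_elt b) -> local_ring B.
Proof.
move=> B1 rad; apply/local_ringP; split=> // b; have [q [r [q_char bq]]] := rad b.
have q_gt0 : (0 < q)%N by case/andP: q_char.
have [ur|nr] := pselect (invertible r).
  left; apply: invertible_point => K rho rho_surj.
  have : rho b ^+ q != 0 by rewrite bq //; apply: (invertible_neq0 (rho \o f)).
  by rewrite expf_eq0 q_gt0.
right; apply: invertible_point => K rho rho_surj.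
have /eqP : rho b ^+ q = 0 by rewrite bq //; apply: integral_lying_over nr.
by rewrite expf_eq0 q_gt0 rmorphB rmorph1 => /eqP ->; rewrite subr0 oner_neq0.
Qed.

End Radicial.

(** The residue field of [A] is algebraic, hence radicial, over that of [R]; and the
    maximal ideal of [A] vanishes at every closed point of the integral [A]-algebra [B]. *)
Lemma local_radicial (R A B : comPzRingType) (f : {rmorphism R -> A}) (i : {rmorphism A -> B})
    (g : {rmorphism R -> B}) (k : fieldType) (pi : {rmorphism R -> k}) :
  local_ring R -> surjective pi -> separably_closed k ->
  local_ring A -> integral_map f -> integral_map g -> (forall x, i (f x) = g x) ->
  forall a, radicial_elt g k (i a).
Proof.
move=> locR pi_surj k_closed locA f_int g_int ig a.
have i_int : integral_map i.
  by move=> b; apply: (integral_elt_rmorph (p := f) (g := idfun)) (g_int b).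
have [K [rho rho_surj]] := local_point locA.
have [h hE] := residue_rmorphism locR pi_surj f_int rho_surj.
have /(@integral_eltP k K h)[P P_monic Pa] := integral_elt_rmorph hE (f_int a).
have [q [d [q_char aq]]] := sep_closed_radicial k_closed (monic_neq0 P_monic) Pa.
have [r rd] := pi_surj d; exists q, r; split=> // K' rho' rho'_surj.
have na : ~ invertible (a ^+ q - f r).
  by apply/(local_kernel locA _ rho_surj); rewrite rmorphB rmorphXn aq -rd hE subrr.
have := integral_lying_over locA i_int rho'_surj na.
by rewrite rmorphB rmorphXn rmorphB rmorphXn ig => /subr0_eq.
Qed.

(** * Tensor products of finitely many algebras *)

Section TensorAlgebraFacts.
Context (R : comPzRingType) (J : finType) (A : J -> algebra R).
Local Notation T := (alg_tensor A).
Local Notation M := (fun j => restr (alg_map (A j)) : lmodType R).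

Lemma tensor_map_mul a (x : T) : tensor_map A a * x = a *: x.
Proof. by rewrite /tensor_map /= -alg_tensor_scaleAl mul1r. Qed.

Let one_at j (a : A j) : forall i, A i := dfwith (fun i => 1 : A i) a.

Let pure_one_at j : linear (fun a : M j => alg_pure (one_at (a : A j)) : tensor M).
Proof. exact: (@pure_multilinear R J M (fun i => 1 : A i) j). Qed.

Fact coproj_exists j : {g : {rmorphism A j -> T} | forall a, g a = alg_pure (one_at a)}.
Proof.
have l0 := pure_one_at (j := j); apply: rmorphism_ex => [x y||x y].
- have := l0 (-1) y x; rewrite !scaleN1r => h.
  by rewrite addrC; have := h; rewrite addrC => ->; rewrite addrC.
- rewrite -[RHS]alg_pure1; congr alg_pure; apply: functional_extensionality_dep => i.
  by rewrite /one_at; case: dfwithP.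
- rewrite -alg_pureM; congr alg_pure; apply: functional_extensionality_dep => i.
  rewrite /pmul /one_at; have [<-|ji] := eqVneq j i; first by rewrite !dfwith_in.
  by rewrite !dfwith_out // mulr1.
Qed.

Definition coproj j : {rmorphism A j -> T} := sval (coproj_exists j).

Lemma coprojE j a : coproj j a = alg_pure (one_at a).
Proof. exact: svalP (coproj_exists j) a. Qed.

Lemma coproj_map j a : coproj j (alg_map (A j) a) = tensor_map A a.
Proof.
have := pure_one_at (j := j) a 1 0; rewrite addr0 => h.
have e0 : alg_pure (one_at (0 : A j)) = 0 by rewrite -coprojE rmorph0.
have e1 : alg_pure (one_at (1 : A j)) = 1 by rewrite -coprojE rmorph1.
rewrite coprojE; transitivity (a *: (alg_pure (one_at (1 : A j)) : tensor M) +
  alg_pure (one_at (0 : A j))).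
  by rewrite -h; congr (alg_pure (one_at _)); rewrite [RHS]restr_scaleE mulr1.
by rewrite e0 e1 addr0.
Qed.

Lemma alg_pure_prod (x : forall j, A j) : alg_pure x = \prod_j coproj j (x j).
Proof.
have prodE (s : seq J) : \prod_(j <- s) coproj j (x j) =
    alg_pure (fun i => \prod_(j <- s) one_at (x j) i).
  elim: s => [|j s IHs].
    rewrite big_nil -alg_pure1; congr alg_pure.
    by apply: functional_extensionality_dep => i; rewrite big_nil.
  rewrite big_cons IHs coprojE -alg_pureM; congr alg_pure.
  by apply: functional_extensionality_dep => i; rewrite big_cons.
rewrite prodE; congr alg_pure; apply: functional_extensionality_dep => i.
rewrite (bigD1 i) //= [one_at _ _]dfwith_in big1 ?mulr1 // => j ji.
by rewrite [LHS]dfwith_out.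
Qed.

Lemma alg_tensor_ind (Q : T -> Prop) :
  (forall x, Q (alg_pure x)) -> (forall a p, Q p -> Q (tensor_map A a * p)) ->
  Q 0 -> (forall p q, Q p -> Q q -> Q (p + q)) -> forall p, Q p.
Proof.
move=> Qpure QM Q0 QD p; have [s ->] := alg_tensor_sum p.
by elim/big_ind: _ => // -[a x] _; rewrite -tensor_map_mul; apply: QM.
Qed.

Lemma functional_tensor (l : forall j, A j -> R) :
  (forall j, functional (alg_map (A j)) (l j)) ->
  exists2 L : T -> R, functional (tensor_map A) L &
    forall x, L (alg_pure x) = \prod_j l j (x j).
Proof.
move=> lfun; have ml : @multilinear_map R J M R^o (fun x => \prod_j l j (x j)).
  move=> x j a y z; have [lD lM] := lfun j.
  have E (w : M j) : \prod_i l i (dfwith x w i) = l j w * \prod_(i | i != j) l i (x i).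
    rewrite (bigD1 j) //= dfwith_in; congr (_ * _); apply: eq_bigr => i ij.
    by rewrite dfwith_out // eq_sym.
  by rewrite !E lD [l j (a *: y)]lM mulrDl -mulrA.
have [h [hE _]] := tensor_univ ml.
exists (h : T -> R) => //; split=> [x y|a x]; first exact: linearD.
by rewrite tensor_map_mul; exact: linearZ_LR.
Qed.

(** The pure tensors of basis elements form a basis, with product coordinates. *)
Lemma finite_split_tensor :
  (forall j, finite_split (alg_map (A j))) -> finite_split (tensor_map A).
Proof.
move=> split_A; split; last first.
  have /fin_all_exists[L L1] j : exists L : A j -> R,
      functional (alg_map (A j)) L /\ exists x, L x = 1.
    by have [_ [L LF L1]] := split_A j; exists L.
  have /fin_all_exists[x x1] j : exists x, L j x = 1 by exact: (L1 j).2.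
  have [l lF lE] := functional_tensor (fun j => (L1 j).1).
  by exists l => //; exists (alg_pure x); rewrite lE big1 // => j _.
have /fin_all_exists[n nP] j : exists n, exists (e : 'I_n -> A j) (l : 'I_n -> A j -> R),
    dual_basis (alg_map (A j)) e l.
  by have [[n bn] _] := split_A j; exists n.
(* All bases are padded to the common length [N], so that choosing a basis element in
   each factor is the same as giving a map [J -> 'I_N]. *)
pose N := (\max_j n j)%N.
have /fin_all_exists[e eP] j : exists e : 'I_N -> A j, exists l : 'I_N -> A j -> R,
    dual_basis (alg_map (A j)) e l.
  have [e [l el]] := nP j.
  by have [e' [l' el']] := dual_basis_widen (leq_bigmax j : (n j <= N)%N) el; exists e', l'.
have /fin_all_exists[l lP] := eP.
have /boolp.choice[L LP] (phi : {ffun J -> 'I_N}) : exists L : T -> R,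
    functional (tensor_map A) L /\ forall x, L (alg_pure x) = \prod_j l j (phi j) (x j).
  by have [L] := functional_tensor (fun j => (lP j).1 (phi j)); exists L.
suff [e' [l' el']] : exists (e' : {ffun J -> 'I_N} -> T) (l' : {ffun J -> 'I_N} -> T -> R),
    dual_basis (tensor_map A) e' l'.
  exists #|{: {ffun J -> 'I_N}}|, (e' \o enum_val), (l' \o enum_val).
  split=> [i|s]; first exact: el'.1.
  rewrite [LHS]el'.2 (reindex (@enum_val {ffun J -> 'I_N} predT)) //=.
  by apply: onW_bij; apply: enum_val_bij.
exists (fun phi => alg_pure (fun j => e j (phi j))), L; split=> [phi|]; first exact: (LP phi).1.
elim/alg_tensor_ind => [x|a p IHp||p q IHp IHq].
- rewrite [LHS]alg_pure_prod.
  transitivity (\prod_j \sum_(i < N) coproj j (alg_map (A j) (l j i (x j)) * e j i)).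
    by apply: eq_bigr => j _; rewrite -rmorph_sum /= -(lP j).2.
  rewrite bigA_distr_bigA /=; apply: eq_bigr => phi _.
  rewrite (LP phi).2 alg_pure_prod rmorph_prod -big_split /=; apply: eq_bigr => j _.
  by rewrite rmorphM coproj_map.
- rewrite {1}IHp mulr_sumr; apply: eq_bigr => phi _.
  by rewrite (LP phi).1.2 rmorphM mulrA.
- rewrite big1 // => phi _.
  have [LD _] := (LP phi).1.
  have -> : L phi 0 = 0 by apply: (addrI (L phi 0)); rewrite -LD !addr0.
  by rewrite rmorph0 mul0r.
- rewrite {1}IHp {1}IHq -big_split; apply: eq_bigr => phi _.
  by rewrite (LP phi).1.1 rmorphD mulrDl.
Qed.

End TensorAlgebraFacts.

(** * The step from R to R_+ *)

(** As [Q]-modules, [A] is a direct summand of a power of [R] and [R] one of [A]. *)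
Lemma flat_pure_finite_split (Q R A : comPzRingType) (h : {rmorphism Q -> R})
    (f : {rmorphism R -> A}) (g : {rmorphism Q -> A}) :
  (forall x, g x = f (h x)) -> finite_split f -> flat h /\ pure_map h -> flat g /\ pure_map g.
Proof.
move=> gE [[n [e [l [lF lE]]]] [L [LD LM] [x Lx]]] [h_flat h_pure]; split.
  have a_ex k : {a : {linear restr g -> restr h} | a =1 l k}.
    apply: restr_linear => [y z|a y]; first exact: (lF k).1.
    by rewrite gE; apply: (lF k).2.
  have b_ex k : {b : {linear restr h -> restr g} | b =1 fun r => f r * e k}.
    apply: restr_linear => [y z|a y]; first by rewrite rmorphD mulrDl.
    by rewrite gE rmorphM mulrA.
  apply: (flat_retract (a := fun k => sval (a_ex k)) (b := fun k => sval (b_ex k))) h_flat => s.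
  by rewrite [RHS]lE; apply: eq_bigr => k _; rewrite (svalP (b_ex k)) (svalP (a_ex k)).
have [a aE] : {a : {linear restr g -> restr h} | a =1 fun y => L (x * y)}.
  apply: restr_linear => [y z|a y]; first by rewrite mulrDr LD.
  by rewrite gE mulrCA LM.
by apply: (pure_retract (a := a)) h_pure; rewrite aE mulr1.
Qed.

Section InsertOne.
Context (R : comPzRingType) (I : choiceType) (A : I -> algebra R).
Local Open Scope fset_scope.

Lemma insert_one_comp (phi psi chi : {fset I}) (s : phi `<=` psi) (s' : psi `<=` chi)
    (s'' : phi `<=` chi) (x : fset_tensor A phi) :
  insert_one s' (insert_one s x) = insert_one s'' x.
Proof.
have map_insert (phi' psi' : {fset I}) (s0 : phi' `<=` psi') b :
    insert_one (A := A) s0 (tensor_map (fun i : phi' => A (val i)) b) =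
    tensor_map (fun i : psi' => A (val i)) b.
  by have := insert_one_map A s0 b; rewrite /fset_tensor_map /=.
pose f : {rmorphism fset_tensor A phi -> fset_tensor A psi} := insert_one s.
pose g : {rmorphism fset_tensor A psi -> fset_tensor A chi} := insert_one s'.
pose h : {rmorphism fset_tensor A phi -> fset_tensor A chi} := insert_one s''.
change (g (f x) = h x).
elim/alg_tensor_ind: x => [x|a p IHp||p q IHp IHq].
- rewrite /f /g /h /= !insert_one_pure; congr alg_pure.
  apply: functional_extensionality_dep => k.
  rewrite /extend_one; case: eqP => [kpsi|kpsi] /=; case: eqP => [kphi|kphi] //=.
  by case: kpsi; apply: (fsubsetP s).
- rewrite (rmorphM f) (rmorphM g) (rmorphM h) IHp; congr (_ * _).
  by rewrite /f /g /h /= !map_insert.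
- by rewrite (rmorph0 f) (rmorph0 g) (rmorph0 h).
- by rewrite (rmorphD f) (rmorphD g) (rmorphD h) IHp IHq.
Qed.

Lemma fsubset_directed : directed (@fsubset I).
Proof.
split=> [|phi|phi psi chi|phi psi]; first by exists fset0.
- exact: fsubset_refl.
- exact: fsubset_trans.
- by exists (phi `|` psi); [exact: fsubsetUl|exact: fsubsetUr].
Qed.

End InsertOne.

(** [A] has no idempotents because its spectrum is connected. *)
Lemma connected_fppf_local (R : comPzRingType) (A : algebra R) :
  henselian R -> connected_fppf A ->
  [/\ local_ring A, integral_map (alg_map A) & finite_split (alg_map A)].
Proof.
move=> hensR [[A_fin _ A_ff] A_conn]; have [locR _] := hensR.
have A_int := finite_integral A_fin.
have A1 := faithfully_flat_neq0 (local_neq0 locR) A_ff.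
split=> //.
  by apply: (henselian_integral_local hensR A_int) => // e; apply: connected_idempotent.
by apply: local_finite_flat_split => // M N P u v /(A_ff _ _ _ u v).
Qed.

Section Plus.
Context (R S : comPzRingType) (f : {rmorphism R -> S}).
Hypotheses (slR : strictly_local R) (plus : is_plus f).

(** Locality is checked on the images of the algebras [A i], which generate [S]; the rest
    on the stages [A_phi] of the colimit. *)
Lemma plus_properties :
  [/\ local_ring S, integral_map f &
    forall (Q : comPzRingType) (h : {rmorphism Q -> R}) (g : {rmorphism Q -> S}),
      (forall x, g x = f (h x)) -> flat h /\ pure_map h -> flat g /\ pure_map g].
Proof.
have [hensR [k [pi [pi_surj k_closed]]]] := slR; have [locR _] := hensR.
have [I [A [[A_fppf _] [c [colim cf]]]]] := plus.
have dir := fsubset_directed I.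
have A_props i := connected_fppf_local hensR (A_fppf i).
have comp := @insert_one_comp R I A.
have c_surj := colimit_surj dir colim.
have c_eq0 := colimit_eq0 dir comp colim.
have split_phi phi : finite_split (fset_tensor_map A phi).
  by apply: finite_split_tensor => j; have [] := A_props (val j).
have f_int : integral_map f.
  move=> s; have [phi [x <-]] := c_surj s.
  have x_int := finite_integral (finite_split_finite (split_phi phi)) x.
  apply: (integral_elt_rmorph (p := id)) x_int.
  by move=> y; rewrite cf.
have S1 : (1 : S) <> 0.
  have [[phi _] _ _ _] := dir.
  rewrite -(rmorph1 (c phi)) => /c_eq0 ev; have [psi phipsi] := eventually_ex dir phi ev.
  move/(_ phipsi); rewrite rmorph1.
  exact: (finite_split_neq0 (local_neq0 locR) (split_phi psi)).
split=> //.
  apply: (radicial_local locR f_int (k := k)) => // s; have [phi [x <-]] := c_surj s.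
  have radD := radicialD pi_surj locR f_int;
  elim/alg_tensor_ind: x => [x|a p IHp||p q IHp IHq].
  - rewrite alg_pure_prod rmorph_prod; apply: radicial_prod => j.
    have [locA A_int _] := A_props (val j).
    pose i := c phi \o coproj (fun i : phi => A (val i)) j.
    apply: (local_radicial (i := i) locR pi_surj k_closed locA A_int f_int).
    by move=> a; rewrite /= coproj_map; apply: cf.
  - rewrite rmorphM; apply: radicialM => //.
    rewrite -[tensor_map _ a]/(fset_tensor_map A phi a) cf; exact: radicial_scalar.
  - by rewrite rmorph0 -(rmorph0 f); apply: radicial_scalar.
  - by rewrite rmorphD; apply: radD.
move=> Q h g gE hfp.
pose g' phi : {rmorphism Q -> fset_tensor A phi} := fset_tensor_map A phi \o h.
have g'_fp phi : flat (g' phi) /\ pure_map (g' phi).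
  by apply: (flat_pure_finite_split (f := fset_tensor_map A phi)) hfp.
have tg phi psi (s : (phi `<=` psi)%fset) x : insert_one s (g' phi x) = g' psi x.
  exact: insert_one_map.
have cg phi x : c phi (g' phi x) = g x by rewrite gE -(cf phi).
split.
  apply: (flat_colimit dir comp _ c_surj c_eq0 tg cg) => [i j ij x|phi];
    last exact: (g'_fp phi).1.
  exact: (colimit_compat colim).
apply: (pure_colimit dir comp _ c_surj c_eq0 tg cg) => [i j ij x|phi];
    last exact: (g'_fp phi).2.
exact: (colimit_compat colim).
Qed.

End Plus.

(** * Transfinite towers *)

Import Order.TTheory.

Lemma well_order_ind (d : Order.disp_t) (W : orderType d) (P : W -> Prop) :
  well_order (fun u v : W => (u <= v)%O) ->
  (forall w, (forall u, (u < w)%O -> P u) -> P w) -> forall w, P w.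
Proof.
move=> wo step w; apply: contrapT => nPw.
have [|z [[/asboolP nPz z_min] _]] := wo (fun u => `[< ~ P u >]).
  by exists w; apply/asboolP.
apply: nPz; apply: step => u uz; apply: contrapT => nPu.
by have := z_min u (asboolT nPu); rewrite leNgt uz.
Qed.

Lemma ordinal_cases (d : Order.disp_t) (W : orderType d) (w : W) :
  [\/ zero_ordinal w, exists v, successor_of v w | limit_ordinal w].
Proof.
have [w0|/existsNP[u uw]] := pselect (zero_ordinal w); first exact: Or31.
have [sw|/forallNP nsw] := pselect (exists v, successor_of v w); first exact: Or32.
apply: Or33; split; first by exists u; rewrite ltNge; apply/negP.
move=> v vw; apply: contrapT => h; apply: (nsw v); split=> // v' v'w.
by rewrite leNgt; apply/negP => vv'; apply: h; exists v'.
Qed.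

Lemma local_map_integral (R S : comPzRingType) (f : {rmorphism R -> S}) :
  local_ring R -> integral_map f -> local_map f.
Proof.
move=> locR f_int m n mm mn x /(local_maximalP locR mm) nx.
have [K [rho [rho_surj rn]]] := residue_field mn.
by apply/rn; apply: integral_lying_over f_int rho_surj nx.
Qed.

Section Tower.
Context (R : comPzRingType) (R_sl : strictly_local R).
Context (d : Order.disp_t) (W : orderType d).
Hypothesis W_wo : well_order (fun u v : W => (u <= v)%O).
Context (T : plus_tower W R).
Local Notation t := (@transition d W R T).
Local Open Scope order_scope.

Let good (w : W) : Prop :=
  local_ring (T w) /\ forall v (vw : v <= w),
    integral_map (t vw) /\ flat (t vw) /\ pure_map (t vw).

Lemma tower_zero_ordinal (w : W) : exists2 w0, zero_ordinal w0 & w0 <= w.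
Proof.
have [|z [[_ z_min] _]] := W_wo (A := predT); first by exists w.
by exists z => [u|]; apply: z_min.
Qed.

Lemma tower_zero (w : W) : zero_ordinal w -> local_ring (T w) /\ strictly_local (T w).
Proof.
move=> w0; have [i [j ij ji]] := stage_zero T w0.
have locR : local_ring R by case: R_sl => -[].
have locT : local_ring (T w).
  have [R1 RU] := (local_ringP R).1 locR; apply/local_ringP; split=> [e|x].
    by apply: R1; rewrite -[LHS]ij rmorph1 e -(rmorph0 i) ij.
  rewrite -[x]ji -(rmorph1 i) -rmorphB.
  by have [h|h] := RU (j x); [left|right]; apply: invertible_rmorph.
split=> //; apply: (strictly_local_integral (f := i)) => //.
apply: finite_integral; exists 1%N, (fun=> 1) => s; exists (fun=> j s).
by rewrite big_ord1 mulr1 ji.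
Qed.

Lemma good_strictly_local (w : W) : good w -> strictly_local (T w).
Proof.
move=> [loc tr]; have [w0 w0_zero w0w] := tower_zero_ordinal w.
exact: strictly_local_integral (tower_zero w0_zero).2 (tr _ w0w).1 loc.
Qed.

Lemma good_id (w : W) (ww : w <= w) :
  integral_map (t ww) /\ flat (t ww) /\ pure_map (t ww).
Proof.
split; last by apply: (flat_pure_id (f := t ww)) => x; apply: transition_id.
apply: finite_integral; exists 1%N, (fun=> 1) => s; exists (fun=> s).
by rewrite big_ord1 mulr1 transition_id.
Qed.

Lemma good_intro (w : W) : local_ring (T w) ->
  (forall v (vw : v < w), integral_map (t (ltW vw)) /\
     flat (t (ltW vw)) /\ pure_map (t (ltW vw))) -> good w.
Proof.
move=> loc tr; split=> // v vw; have [vw'|] := boolP (v < w).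
  by rewrite (bool_irrelevance vw (ltW vw')); apply: tr.
rewrite -leNgt => wv; have e : v = w by apply: le_anti; rewrite vw wv.
by case: _ / e in vw wv *; apply: good_id.
Qed.

Lemma good_successor (v w : W) : successor_of v w -> good v -> good w.
Proof.
move=> [vw vmax] gv; have [loc_v tr_v] := gv.
have plus_vw := stage_succ T (ltW vw) (conj vw vmax).
have [loc int_vw fp] := plus_properties (good_strictly_local gv) plus_vw.
apply: good_intro => // u uw; have [uv_int uv_fp] := tr_v u (vmax u uw).
have tE x : t (ltW uw) x = t (ltW vw) (t (vmax u uw) x).
  by rewrite (transition_comp _ _ (ltW uw)).
by split; [exact: integral_trans uv_int int_vw|exact: fp uv_fp].
Qed.

Section Limit.
Context (w : W) (w_lim : limit_ordinal w) (IH : forall u, u < w -> good u).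

Let below : Type := {u : W | u < w}.
Let le_below : rel below := fun u v => val u <= val v.

Lemma below_directed : directed le_below.
Proof.
split.
- by have [u uw] := w_lim.1; exists (exist (fun u => u < w) u uw).
- by move=> u; apply: lexx.
- by move=> u v z; apply: le_trans.
- move=> u v; have [uv|vu] := leP (val u) (val v).
    by exists v => //; apply: lexx.
  by exists u; [apply: lexx|apply: ltW].
Qed.

Let t_comp (u v z : below) (uv : le_below u v) (vz : le_below v z) (uz : le_below u z) x :
  t vz (t uv x) = t uz x.
Proof. exact: transition_comp. Qed.

Let c (u : below) : {rmorphism T (val u) -> T w} := t (ltW (valP u)).

Let c_surj : forall s, exists u x, c u x = s.
Proof.
move=> s; have [u [x xs]] := colimit_surj below_directed (stage_limit T w_lim) s.
by exists u, x.
Qed.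

Let c_eq0 u x : c u x = 0 ->
  eventually le_below (fun v => forall uv : le_below u v, t uv x = 0).
Proof. exact: (colimit_eq0 below_directed t_comp (stage_limit T w_lim)). Qed.

Lemma limit_local : local_ring (T w).
Proof.
have [[u0 _] _ _ _] := below_directed; apply/local_ringP; split=> [e|s].
  have [|v uv] := eventually_ex below_directed u0 (@c_eq0 u0 1 _); first by rewrite rmorph1.
  by move/(_ uv); rewrite rmorph1; apply: local_neq0 (IH (valP v)).1.
have [u [x <-]] := c_surj s; rewrite -(rmorph1 (c u)) -rmorphB.
have /local_ringP[_ /(_ x)] := (IH (valP u)).1.
by case=> h; [left|right]; apply: invertible_rmorph.
Qed.

(** The stages from [v] on are cofinal below [w], and are all algebras over stage [v]. *)
Section Cofinal.
Context (v : W) (vw : v < w).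

Let above : Type := {u : W | v <= u < w}.
Let le_above : rel above := fun u z => val u <= val z.
Let above_lt (u : above) : val u < w. Proof. by case/andP: (valP u). Qed.
Let above_ge (u : above) : v <= val u. Proof. by case/andP: (valP u). Qed.

Let raise (u : W) : u < w -> exists2 z : above, u <= val z & True.
Proof.
move=> uw; have [uv|vu] := leP u v.
  have vP : v <= v < w by rewrite lexx.
  by exists (exist (fun u => v <= u < w) v vP).
have uP : v <= u < w by rewrite ltW.
by exists (exist (fun u => v <= u < w) u uP) => //; apply: lexx.
Qed.

Let above_directed : directed le_above.
Proof.
split.
- by have [z _ _] := raise vw; exists z.
- by move=> u; apply: lexx.
- by move=> u z y; apply: le_trans.
- move=> u z; have [uz|zu] := leP (val u) (val z).
    by exists z => //; apply: lexx.
  by exists u; [apply: lexx|apply: ltW].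
Qed.

Let t_comp' (u y z : above) (uy : le_above u y) (yz : le_above y z) (uz : le_above u z) x :
  t yz (t uy x) = t uz x.
Proof. exact: transition_comp. Qed.

Let c' (u : above) : {rmorphism T (val u) -> T w} := t (ltW (above_lt u)).

Let c't (u z : above) (uz : le_above u z) x : c' z (t uz x) = c' u x.
Proof. exact: transition_comp. Qed.

Let c'_surj s : exists u x, c' u x = s.
Proof.
have [u [x <-]] := c_surj s; have [z uz _] := raise (valP u).
by exists z, (t uz x); apply: transition_comp.
Qed.

Let c'_eq0 (u : above) x : c' u x = 0 ->
  eventually le_above (fun z => forall uz : le_above u z, t uz x = 0).
Proof.
pose u' : below := exist (fun u => u < w) (val u) (above_lt u).
have -> : c' u x = c u' x.
  by rewrite /c' /c (bool_irrelevance (ltW (above_lt u)) (ltW (valP u'))).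
move=> /c_eq0[y yP]; have [z yz _] := raise (valP y).
exists z => k zk uk; pose k' : below := exist (fun u => u < w) (val k) (above_lt k).
exact: (yP k' (le_trans yz zk) uk).
Qed.

Lemma limit_transition :
  integral_map (t (ltW vw)) /\ flat (t (ltW vw)) /\ pure_map (t (ltW vw)).
Proof.
pose g u : {rmorphism T v -> T (val u)} := t (above_ge u).
have gP u : integral_map (g u) /\ flat (g u) /\ pure_map (g u).
  exact: (IH (above_lt u)).2.
have tg u z (uz : le_above u z) x : t uz (g u x) = g z x by exact: transition_comp.
have cg u x : c' u (g u x) = t (ltW vw) x by exact: transition_comp.
split; [|split].
- move=> s; have [u [x <-]] := c'_surj s.
  exact: (integral_elt_rmorph (p := id)) (fun y => esym (cg u y)) ((gP u).1 x).
- apply: (flat_colimit above_directed t_comp' c't c'_surj c'_eq0 tg cg) => u.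
  by case: (gP u) => _ [].
- apply: (pure_colimit above_directed t_comp' c't c'_surj c'_eq0 tg cg) => u.
  by case: (gP u) => _ [].
Qed.

End Cofinal.

Lemma good_limit : good w.
Proof. exact: good_intro limit_local limit_transition. Qed.

End Limit.

Lemma tower_good (w : W) : good w.
Proof.
apply: (well_order_ind W_wo) w => w IH.
have [w0|[v vw]|w_lim] := ordinal_cases w.
- apply: good_intro; first exact: (tower_zero w0).1.
  by move=> v vw; have := w0 v; rewrite leNgt vw.
- exact: good_successor vw (IH v vw.1).
- exact: good_limit.
Qed.

End Tower.

Theorem proposition5p2
    (R : comPzRingType) (R_strictly_local : strictly_local R)
    (d : Order.disp_t) (W : orderType d)
    (W_well_order : well_order (fun u v : W => (u <= v)%O))
    (T : plus_tower W R) (nu : W) :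
  strictly_local (T nu) /\
  forall (gamma : W) (gamma_nu : (gamma <= nu)%O),
    let t := transition T gamma_nu in
    [/\ local_map t, faithfully_flat t & integral_map t].
Proof.
have good := tower_good R_strictly_local W_well_order T.
split=> [|gamma gamma_nu t].
  exact: (good_strictly_local R_strictly_local W_well_order (good nu)).
have [t_int [t_flat t_pure]] := (good nu).2 gamma gamma_nu.
split=> //; last exact: flat_pure_faithful.
exact: local_map_integral (good gamma).1 t_int.
Qed.
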